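(* Fix an integer $k\ge 2$. For $n\ge k$ and $\alpha\ge0$ let $F(n,\alpha)$ be the random $k$-CNF formula on $n$ variables in which each of the $N=\binom{n}{k}2^k$ possible $k$-clauses is included independently with probability $\alpha n/N$, and let $Z(F)$ be the number of satisfying assignments of $F$. Let $$\alpha^*:=\sup\big\{\alpha:\ \mathbb{P}\{Z(F(n,\alpha))=0\}=O\big(1/(\log n)^{1+\varepsilon}\big)\text{ for some }\varepsilon>0\big\},$$ and $$\psi_n(\alpha):=\frac1n\,\mathbb{E}\big[\log Z(F(n,\alpha))\,\big|\,Z(F(n,\alpha))\ge1\big].$$ Then for every $\alpha<\alpha^*$, $\psi_n(\alpha)$ converges as $n\to\infty$ to a limit $\phi_s(\alpha)$.
   Context: A $k$-clause is a disjunction of $k$ literals on $k$ distinct variables among $x_1,\dots,x_n$; $F(n,\alpha)$ is the conjunction of the selected clauses. *)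

(* Defs.v *)
From mathcomp Require Import all_boot all_order all_algebra.
From mathcomp Require Import all_classical all_reals all_analysis.

Set Implicit Arguments.
Unset Strict Implicit.
Unset Printing Implicit Defensive.

Import Order.TTheory GRing.Theory Num.Theory.
Import numFieldNormedType.Exports.

Local Open Scope classical_set_scope.
Local Open Scope ring_scope.

(* The literal (i, true) is x_i and (i, false) is its negation. *)
Definition literal (n : nat) := ('I_n * bool)%type.

(* The second condition forces the k literals to involve k distinct variables. *)
Definition is_kclause (k n : nat) (C : {set literal n}) : bool :=
  (#|C| == k) && (#|[set l.1 | l in C]%SET| == k).

Definition kclause (k n : nat) := {C : {set literal n} | is_kclause k C}.

(* A formula is the set of its selected clauses. *)
Definition formula (k n : nat) := {set kclause k n}.

Definition assignment (n : nat) := {ffun 'I_n -> bool}.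

Definition satisfies (k n : nat) (s : assignment n) (F : formula k n) : bool :=
  [forall C in F, [exists l in val C, s l.1 == l.2]].

Definition Z (k n : nat) (F : formula k n) : nat :=
  #|[pred s : assignment n | satisfies s F]|.

Section RandomFormula.
Variables (R : realType) (k n : nat) (alpha : R).

Definition num_kclauses : nat := ('C(n, k) * 2 ^ k)%N.

(* The cap at 1 is reached for finitely many n only when 2 <= k; it makes
   [formula_pr] a genuine probability for every n. *)
Definition clause_pr : R := Num.min 1 (alpha * n%:R / num_kclauses%:R).

(* Probability that F(n, alpha) = F. *)
Definition formula_pr (F : formula k n) : R :=
  \prod_(C : kclause k n) (if C \in F then clause_pr else 1 - clause_pr).

Definition Pr (E : pred (formula k n)) : R :=
  \sum_(F : formula k n | E F) formula_pr F.

(* E[X | E], with the value 0 when Pr E = 0. *)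
Definition cond_expectation (X : formula k n -> R) (E : pred (formula k n)) : R :=
  (\sum_(F : formula k n | E F) formula_pr F * X F) / Pr E.

Definition unsat_pr : R := Pr (fun F => Z F == 0%N).

Definition psi : R :=
  n%:R^-1 * cond_expectation (fun F => ln (Z F)%:R) (fun F => (1 <= Z F)%N).

End RandomFormula.

Definition alpha_star (R : realType) (k : nat) : \bar R :=
  ereal_sup [set alpha%:E | alpha in
    [set alpha : R | 0 <= alpha /\
      exists2 eps : R, 0 < eps &
        (fun n : nat => unsat_pr k n alpha) =O_\oo
        (fun n : nat => 1 / (ln n%:R) `^ (1 + eps))]].

Lemma card_kclause (k n : nat) : #|{: kclause k n}| = num_kclauses k n.
Proof.
pose f (p : {set 'I_n} * {set 'I_n}) : {set literal n} :=
  [set (i, i \in p.2) | i in p.1]%SET.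
pose D := [set p : {set 'I_n} * {set 'I_n} |
  (#|p.1| == k) && (p.2 \subset p.1)]%SET.
have inf p i b : ((i, b) \in f p) = (i \in p.1) && (b == (i \in p.2)).
  apply/imsetP/andP => [[j jp [-> ->]] //|[ip /eqP ->]]; by exists i.
have fstf p : [set l.1 | l in f p]%SET = p.1.
  apply/setP => i; apply/imsetP/idP => [[[j b]]|ip].
    by rewrite inf => /andP[jp _] ->.
  by exists (i, i \in p.2) => //; rewrite inf ip eqxx.
have finj : {in D &, injective f}.
  move=> [S T] [S' T']; rewrite !inE /= => /andP[_ TS] /andP[_ TS'] eqf.
  have eS : S = S' by rewrite -[S](fstf (S, T)) eqf fstf.
  congr (_, _) => //; subst S'; apply/setP => i.
  have := inf (S, T) i true; rewrite eqf inf /=.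
  case iS: (i \in S) => /=; first by do 2 case: (i \in _).
  by rewrite (contraFF (fintype.subsetP TS i) iS) (contraFF (fintype.subsetP TS' i) iS).
have imf : [set C | is_kclause k C]%SET = (f @: D)%SET.
  apply/setP => C; rewrite inE; apply/andP/imsetP.
    move=> [/eqP cC /eqP cS].
    have injC : {in C &, injective fst} by apply/imset_injP; rewrite cS cC.
    exists ([set l.1 | l in C]%SET, [set i | (i, true) \in C]%SET).
      rewrite inE /= cS eqxx /=; apply/fintype.subsetP => i; rewrite inE => iC.
      by apply/imsetP; exists (i, true).
    apply/setP => -[i b]; rewrite inf /= inE; apply/idP/andP.
      move=> iC; split; first by apply/imsetP; exists (i, b).
      case: b iC => iC; first by rewrite iC.
      by apply/eqP/esym/negP => iC'; have := injC _ _ iC iC' erefl.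
    move=> [/imsetP[[j c] jC /= ->] /eqP ->].
    case: c jC => jC; first by rewrite jC.
    by case: (boolP ((j, true) \in C)).
  move=> [p]; rewrite inE => /andP[/eqP cp _] ->.
  by rewrite fstf cp eqxx card_imset ?cp // => i j [].
rewrite card_sig -cardsE imf card_in_imset //.
rewrite -sum1dep_card.
rewrite -(pair_big_dep (fun S : {set 'I_n} => #|S| == k)
  (fun S T : {set 'I_n} => T \subset S) (fun _ _ => 1%N)) /=.
under eq_bigr => S /eqP cS.
  rewrite sum1dep_card -/(powerset S) card_powerset cS. over.
by rewrite sum_nat_cond_const /num_kclauses -[in RHS](card_ord n) -card_draws cardsE.
Qed.

Lemma formula_pr_sum1 (R : realType) (k n : nat) (alpha : R) :
  \sum_(F : formula k n) formula_pr alpha F = 1.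
Proof.
transitivity (\prod_(C : kclause k n)
    (clause_pr k n alpha + (1 - clause_pr k n alpha))).
  by rewrite bigA_distr.
by rewrite big1 // => C _; rewrite addrC subrK.
Qed.

(* Main.v *)
(* Write f(F) = ln (1 + Z F).  The added 1 acts as a configuration satisfying
   every clause, so f is finite everywhere and within ln 2 of ln Z when Z >= 1.
   With inclusion probabilities 1 - exp(-lambda_C), moving the rates linearly
   from a formula on n1 + n2 variables to two independent formulas on n1 and n2
   variables changes E f at speed sum_C lambda'_C E[f(C |: F) - f F].  Expanding
   ln (1 - x) and viewing powers as replicas, the sign of this speed reduces to
   convexity of x^k.  Drawing k distinct variables spoils the convexity by O(1)
   clauses in total; this is absorbed by thinning the large formula by a factor
   1 - eta with eta ~ n^(-3/4), which by a chi-square bound costs only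
   O(n^(3/4)).  Finally ln (1 + Z1 Z2) >= ln (1 + Z1) + ln (1 + Z2) - ln 2 unless
   Z1 or Z2 vanishes, so E f is superadditive up to O(n / (log n)^(1+eps)) below
   alpha^*, and E f / n converges. *)

Require Import Defs.
From mathcomp Require Import all_boot all_order all_algebra.
From mathcomp Require Import all_classical all_reals all_analysis.
From mathcomp Require Import ring lra zify.

Set Implicit Arguments.
Unset Strict Implicit.
Unset Printing Implicit Defensive.

Import Order.TTheory GRing.Theory Num.Theory.
Import numFieldNormedType.Exports.

Local Open Scope classical_set_scope.
Local Open Scope ring_scope.

(** * Random subsets with independent elements, and interpolation along their rates *)

Section Bernoulli.
Context {R : realType} {T : finType}.
Implicit Types (p : T -> R) (F : {set T}).

Definition bern p F : R := \prod_C (if C \in F then p C else 1 - p C).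

Definition expect p (f : {set T} -> R) : R := \sum_F bern p F * f F.

(** The probability that a Poisson variable of mean [l C] is nonzero. A second arrival of C does not
    change a set, which is why derivatives in the rate see plain insertions. *)
Definition rate_pr (l : T -> R) (C : T) : R := 1 - expR (- l C).

Lemma bern_ge0 p F : (forall C, 0 <= p C <= 1) -> 0 <= bern p F.
Proof.
move=> p01; apply: prodr_ge0 => C _; have /andP[p0 p1] := p01 C.
by case: ifP => // _; rewrite subr_ge0.
Qed.

Lemma bern_sum1 p : \sum_F bern p F = 1.
Proof.
transitivity (\prod_C (p C + (1 - p C))); first by rewrite bigA_distr.
by rewrite big1 // => C _; rewrite addrC subrK.
Qed.

Lemma expect_cst p c : expect p (fun=> c) = c.
Proof. by rewrite /expect -mulr_suml bern_sum1 mul1r. Qed.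

Lemma expectD p f g : expect p (fun F => f F + g F) = expect p f + expect p g.
Proof. by rewrite /expect -big_split; apply: eq_bigr => F _; rewrite mulrDr. Qed.

Lemma expectZ p a f : expect p (fun F => a * f F) = a * expect p f.
Proof. by rewrite /expect big_distrr; apply: eq_bigr => F _; rewrite mulrCA. Qed.

Lemma expectN p f : expect p (fun F => - f F) = - expect p f.
Proof. by rewrite /expect -sumrN; apply: eq_bigr => F _; rewrite mulrN. Qed.

Lemma expectB p f g : expect p (fun F => f F - g F) = expect p f - expect p g.
Proof. by rewrite expectD expectN. Qed.

Lemma expect_sum p (I : finType) (h : I -> {set T} -> R) :
  expect p (fun F => \sum_i h i F) = \sum_i expect p (h i).
Proof.
by rewrite exchange_big; apply: eq_bigr => F _; rewrite big_distrr.
Qed.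

(** The comparison is asked only of sets without elements of probability 0. At the two-block end of
    the interpolation this discards every set that contains a clause of the large formula. *)
Lemma le_expect p f g : (forall C, 0 <= p C <= 1) ->
  (forall F, (forall C, C \in F -> p C != 0) -> f F <= g F) ->
  expect p f <= expect p g.
Proof.
move=> p01 fg; apply: ler_sum => F _.
have [/existsP[C /andP[CF /eqP pC]]|/existsPn nF] :=
  boolP [exists C, (C \in F) && (p C == 0)].
  by rewrite /bern (bigD1 C) //= CF pC !mul0r.
apply: ler_wpM2l; first exact: bern_ge0.
by apply: fg => C CF; have := nF C; rewrite CF.
Qed.

Lemma is_derive_bigsum (I : Type) (s : seq I) (f : I -> R -> R) (df : I -> R)
    (x : R) : (forall i, is_derive x 1 (f i) (df i)) ->
  is_derive x 1 (fun t => \sum_(i <- s) f i t) (\sum_(i <- s) df i).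
Proof.
move=> fd; elim: s => [|a s IH].
  have -> : (fun t => \sum_(i <- [::]) f i t) = cst 0.
    by apply/funext => t; rewrite big_nil.
  rewrite big_nil; exact: is_derive_cst.
have -> : (fun t => \sum_(i <- a :: s) f i t) =
    f a + (fun t => \sum_(i <- s) f i t).
  by apply/funext => t; rewrite big_cons.
by rewrite big_cons; apply: is_deriveD.
Qed.

Lemma is_derive_bigprod (s : seq T) (f : T -> R -> R) (df : T -> R) (x : R) :
  uniq s -> (forall i, is_derive x 1 (f i) (df i)) ->
  is_derive x 1 (fun t => \prod_(i <- s) f i t)
    (\sum_(i <- s) df i * \prod_(j <- s | j != i) f j x).
Proof.
move=> us fd; elim: s us => [_|a s IH /= /andP[aNs us]].
  have -> : (fun t => \prod_(i <- [::]) f i t) = cst 1.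
    by apply/funext => t; rewrite big_nil.
  rewrite big_nil; exact: is_derive_cst.
have -> : (fun t => \prod_(i <- a :: s) f i t) =
    f a * (fun t => \prod_(i <- s) f i t).
  by apply/funext => t; rewrite big_cons.
apply: (is_derive_eq (is_deriveM (fd a) (IH us))).
rewrite !big_cons eqxx /= addrC; congr (_ + _).
  rewrite /GRing.scale /= mulrC; congr (_ * _).
  rewrite big_seq [in RHS]big_seq_cond; apply: eq_bigl => j.
  by case: eqP => [->|]; rewrite ?(negPf aNs) ?andbT.
rewrite /GRing.scale /= big_distrr /= big_seq [in RHS]big_seq.
apply: eq_bigr => i si; rewrite big_cons ifT 1?mulrCA //.
by apply: contraNneq aNs => ->.
Qed.

(* With rates, i.e. p = 1 - exp(-l), the derivative of the expectation involves
   only insertions into an unconditioned random set. *)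
Lemma is_derive_expect (l d : T -> R) (f : {set T} -> R) (x : R) :
  is_derive x 1 (fun t => expect (rate_pr (fun C => l C + t * d C)) f)
    (expect (rate_pr (fun C => l C + x * d C))
       (fun F => \sum_C d C * (f (C |: F) - f F))).
Proof.
pose w C (b : bool) t := if b then 1 - expR (- (l C + t * d C))
                         else expR (- (l C + t * d C)).
pose dw C (b : bool) := (if b then d C else - d C) * expR (- (l C + x * d C)).
have dwE C b : is_derive x 1 (w C b) (dw C b).
  have e : is_derive x 1 (fun t => - (l C + t * d C)) (- d C).
    apply: is_derive_eq; rewrite /GRing.scale /=; ring.
  have e2 : is_derive x 1 (fun t => expR (- (l C + t * d C)))
      (- d C * expR (- (l C + x * d C))).
    rewrite mulrC; have := is_derive_expR (- (l C + x * d C)).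
    by move/(@is_derive1_comp R _ (fun t => - (l C + t * d C))) => /(_ _ e).
  rewrite /w /dw; case: b => //.
  have -> : (fun t => 1 - expR (- (l C + t * d C))) =
      cst 1 - (fun t => expR (- (l C + t * d C))) by [].
  have h := is_deriveB (is_derive_cst (1 : R) x (1 : R)) e2.
  by apply: is_derive_eq; rewrite sub0r mulNr opprK.
have bernE t F : bern (rate_pr (fun C => l C + t * d C)) F =
    \prod_(C <- index_enum T) w C (C \in F) t.
  by apply: eq_bigr => C _; rewrite /w /rate_pr; case: ifP => //; rewrite opprB addrC subrK.
have -> : (fun t => expect (rate_pr (fun C => l C + t * d C)) f) =
    fun t => \sum_(F <- index_enum {set T})
      (\prod_(C <- index_enum T) w C (C \in F) t * f F).
  by apply/funext => t; apply: eq_bigr => F _; rewrite bernE.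
have dF (F : {set T}) : is_derive x 1
    (fun t => \prod_(C <- index_enum T) w C (C \in F) t * f F)
    ((\sum_C dw C (C \in F) * \prod_(D | D != C) w D (D \in F) x) * f F).
  have h := is_derive_bigprod (index_enum_uniq T) (fun C => dwE C (C \in F)).
  have -> : (fun t => \prod_(C <- index_enum T) w C (C \in F) t * f F) =
     f F *: (fun t => \prod_(C <- index_enum T) w C (C \in F) t).
    by apply/funext => t; rewrite mulrC.
  by apply: is_derive_eq; rewrite /GRing.scale /= mulrC.
apply: (is_derive_eq (is_derive_bigsum _ dF)).
rewrite expect_sum; under eq_bigr do rewrite big_distrl /=.
rewrite exchange_big; apply: eq_bigr => C _.
(* Sets with and without C are paired by [F |-> C |: F]. Since [dw C true] and [dw C false] are
   opposite, each pair leaves the increment of f, weighted by [d C] and the weight of F. On the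
   right, sets that already contain C contribute 0. *)
rewrite expectZ (bigID (fun F : {set T} => C \in F)) /=.
rewrite (reindex_onto (fun F => C |: F) (fun F => F :\ C)) /=; last first.
  by move=> F CF; rewrite finset.setD1K.
rewrite (eq_bigl (fun F : {set T} => C \notin F)); last first.
  move=> F; rewrite !inE eqxx /=; apply/eqP/idP => [<-|CF].
    by rewrite !inE eqxx.
  by rewrite finset.setU1K.
rewrite /expect [in RHS](bigID (fun F : {set T} => C \in F)) /=.
rewrite [X in _ = _ * (X + _)]big1 ?add0r; last first.
  by move=> F CF; rewrite (finset.setUidPr _) ?finset.sub1set // subrr mulr0.
rewrite -big_split big_distrr; apply: eq_bigr => F CF /=.
have CF0 := negbTE CF.
rewrite finset.setU11 CF0 bernE [in RHS](bigD1 C) //= CF0 /dw.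
rewrite (eq_bigr (fun D => w D (D \in F) x)); last first.
  by move=> D DC; rewrite finset.in_setU1 (negPf DC).
by rewrite /w; ring.
Qed.

Lemma rate_pr01 (l : T -> R) : (forall C, 0 <= l C) ->
  forall C, 0 <= rate_pr l C <= 1.
Proof.
move=> l0 C; rewrite /rate_pr subr_ge0 -expR0 ler_expR oppr_le0 l0 /=.
by rewrite gerBl expR_ge0.
Qed.

(** By the mean value theorem the two expectations differ by the derivative at some intermediate
    rate. That derivative is the expectation of the sum in the last hypothesis, so a bound valid for
    every F passes to it. *)
Lemma interpolation (l m : T -> R) (f : {set T} -> R) (c : R) :
  (forall C, 0 <= l C) -> (forall C, 0 <= m C) ->
  (forall F, - c <= \sum_C (l C - m C) * (f (C |: F) - f F)) ->
  expect (rate_pr m) f - c <= expect (rate_pr l) f.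
Proof.
move=> l0 m0 h; pose r t C := m C + t * (l C - m C).
have dE x := is_derive_expect m (fun C => l C - m C) f x.
have cont : {within `[(0 : R), 1], continuous
    (fun t => expect (rate_pr (r t)) f)}.
  by apply: derivable_within_continuous => x ?; have [] := dE x.
have [] := @MVT_segment R _ _ 0 1 ler01 (fun x _ => dE x) cont.
move=> c0; rewrite in_itv /= => /andP[c00 c01].
have -> : rate_pr (r 1) = rate_pr l.
  by apply/funext => C; rewrite /rate_pr /r mul1r (addrC (m C)) subrK.
have -> : rate_pr (r 0) = rate_pr m.
  by apply/funext => C; rewrite /rate_pr /r mul0r addr0.
rewrite subr0 mulr1 => e.
rewrite addrC -lerBrDr e -{1}[- c](expect_cst (rate_pr (r c0))).
apply: le_expect => [|F _]; last exact: h.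
apply: rate_pr01 => C; rewrite /r.
have -> : m C + c0 * (l C - m C) = (1 - c0) * m C + c0 * l C by ring.
by rewrite addr_ge0 // mulr_ge0 // subr_ge0.
Qed.
End Bernoulli.

(** * Marginals and changes of parameter *)

Section BernoulliTransfer.
Context {R : realType}.

Lemma expect_marginal (T T1 : finType) (h : T1 -> T) (p : T -> R)
    (g : {set T1} -> R) : injective h ->
  expect p (fun F => g (h @^-1: F)) = expect (p \o h) g.
Proof.
move=> hI; rewrite /expect (partition_big (fun F : {set T} => h @^-1: F) xpredT) //=.
apply: eq_bigr => G _.
rewrite (eq_bigr (fun F => bern p F * g G)); last by move=> F /eqP ->.
rewrite -big_distrl /=; congr (_ * _).
(* Status b of C is compatible with G being the preimage. The event that F has preimage G becomes a
   product of such indicators, so its probability factors; elements outside the range of h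
   contribute a factor 1. *)
pose ok C b := [forall D, (h D == C) ==> (b == (D \in G))].
transitivity (\prod_C (p C * (ok C true)%:R + (1 - p C) * (ok C false)%:R)).
  rewrite bigA_distr big_mkcond; apply: eq_bigr => F _.
  rewrite (eq_bigr (fun C => (if C \in F then p C else 1 - p C) *
                              (ok C (C \in F))%:R)); last first.
    by move=> C _; case: ifP.
  rewrite big_split /= -/(bern p F); case: eqP => [FG|FG].
    rewrite big1 ?mulr1 // => C _; rewrite [ok _ _](_ : _ = true) //.
    by apply/forallP => D; apply/implyP => /eqP <-; rewrite -FG finset.inE.
  have [C Cn] : exists C, ~~ ok C (C \in F).
    apply/existsP; rewrite -negb_forall; apply/negP => /forallP a; apply: FG.
    apply/setP => D; rewrite finset.inE.
    by have /forallP/(_ D) := a (h D); rewrite eqxx => /eqP.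
  by rewrite [X in _ * X](bigD1 C) //= (negPf Cn) mul0r mulr0.
rewrite (bigID (fun C => C \in codom h)) /= [X in _ * X]big1 ?mulr1; last first.
  move=> C Cn; have a b : ok C b.
    apply/forallP => D; apply/implyP => /eqP e.
    by case/negP: Cn; rewrite -e codom_f.
  by rewrite !a !mulr1 addrC subrK.
rewrite (eq_bigl (fun C => C \in h @: [set: T1]%SET)); last first.
  by move=> C; apply/codomP/imsetP => [[D ->]|[D _ ->]]; exists D; rewrite ?finset.in_setT.
rewrite big_imset /=; last by move=> x y _ _; apply: hI.
apply: eq_big => [D|D _]; first by rewrite finset.inE.
have okE b : ok (h D) b = (b == (D \in G)).
  apply/forallP/eqP => [/(_ D)|-> D']; first by rewrite eqxx => /eqP.
  by apply/implyP => /eqP/hI ->.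
by rewrite !okE; case: (D \in G); rewrite ?mulr1 ?mulr0 ?addr0 ?add0r.
Qed.

(* The chi-square bound on total variation, with the square root linearised by
   AM-GM: [2 |x| <= t x^2 + 1 / t]. *)
Lemma expect_chi2 (T : finType) (p q : T -> R) (f : {set T} -> R) (M t : R) :
  (forall C, 0 < p C < 1) -> 0 < t -> (forall F, `|f F| <= M) ->
  `|expect q f - expect p f| <= M / 2 *
    (t * (\prod_C (q C ^+ 2 / p C + (1 - q C) ^+ 2 / (1 - p C)) - 1) + t^-1).
Proof.
move=> p01 t0 fM.
have bp F : 0 < bern p F.
  apply: prodr_gt0 => C _; have /andP[p0 p1] := p01 C.
  by case: ifP => // _; rewrite subr_gt0.
have M0 : 0 <= M by apply: le_trans (fM finset.set0).
(* The second moment of the likelihood ratio factors over the elements. *)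
have -> : \prod_C (q C ^+ 2 / p C + (1 - q C) ^+ 2 / (1 - p C)) =
    \sum_F bern q F ^+ 2 / bern p F.
  rewrite bigA_distr; apply: eq_bigr => F _.
  rewrite /bern -prodrXl -prodfV -big_split /=.
  by apply: eq_bigr => C _; case: ifP.
have -> : \sum_F bern q F ^+ 2 / bern p F - 1 =
    \sum_F (bern q F - bern p F) ^+ 2 / bern p F.
  have -> : \sum_F (bern q F - bern p F) ^+ 2 / bern p F =
     \sum_F (bern q F ^+ 2 / bern p F - 2 * bern q F + bern p F).
    by apply: eq_bigr => F _; field; rewrite gt_eqF.
  rewrite big_split sumrB -mulr_sumr !bern_sum1 /=; ring.
have -> : t^-1 = \sum_F bern p F / t by rewrite -mulr_suml bern_sum1 mul1r.
rewrite -sumrB mulr_sumr -big_split mulr_sumr.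
apply: le_trans (ler_norm_sum _ _ _) _; apply: ler_sum => F _ /=.
rewrite -mulrBl normrM.
apply: (@le_trans _ _ (`|bern q F - bern p F| * M)); first by apply: ler_wpM2l.
rewrite mulrC -mulrA ler_wpM2l // -subr_ge0.
have := bp F; move: (bern p F) (bern q F) => b a b0; move: (a - b) => d.
have -> : 2^-1 * (t * (d ^+ 2 / b) + b / t) - `|d| =
    (t * `|d| - b) ^+ 2 / (2 * t * b).
  rewrite sqrrB exprMn real_normK ?num_real //; field.
  by rewrite !gt_eqF.
by rewrite divr_ge0 ?sqr_ge0 // !mulr_ge0 // ltW.
Qed.
End BernoulliTransfer.

(** * Partial sums of the logarithm series *)

Section LogSeries.
Context {R : realType}.

(** The remainder vanishes at 0 and has derivative t^L / (1 - t), which on [0, x] lies between 0 and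
    its value at x; the mean value theorem and x < 1 conclude. *)
Lemma neg_ln1B_partial (x : R) (L : nat) : 0 <= x -> x < 1 ->
  \sum_(l < L) x ^+ l.+1 / l.+1%:R <= - ln (1 - x)
    <= \sum_(l < L) x ^+ l.+1 / l.+1%:R + x ^+ L / (1 - x).
Proof.
move=> x0 x1.
pose G := fun t : R => - ln (1 - t) - \sum_(l <- index_enum 'I_L) (l.+1%:R^-1 * t ^+ l.+1).
have dG t : t \in `[0, x] -> is_derive t 1 G (t ^+ L / (1 - t)).
  rewrite in_itv /= => /andP[t0 tx]; have t1 : 0 < 1 - t by rewrite subr_gt0; lra.
  have d1 : is_derive t 1 (fun u : R => 1 - u) (-1).
    have h := is_deriveB (is_derive_cst (1 : R) t (1 : R)) (is_derive_id t (1 : R)).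
    by apply: is_derive_eq; rewrite sub0r.
  have d2 : is_derive t 1 (fun u : R => ln (1 - u)) ((1 - t)^-1 * -1).
    exact: (@is_derive1_comp R (@ln R) (fun u => 1 - u) _ _ _ (is_derive1_ln t1) d1).
  have d3 (l : 'I_L) : is_derive t 1 (fun u : R => l.+1%:R^-1 * u ^+ l.+1) (t ^+ l).
    have h := is_deriveZ l.+1%:R^-1 (is_deriveX l.+1 (is_derive_id t (1 : R))).
    have -> : (fun u : R => l.+1%:R^-1 * u ^+ l.+1) = l.+1%:R^-1 \*: (@id R) ^+ l.+1.
      by apply/funext => u; rewrite exprfctE.
    by apply: is_derive_eq; rewrite /GRing.scale /= mulr1 mulrA mulVf ?mul1r.
  have d4 := is_derive_bigsum (index_enum 'I_L) d3.
  have := is_deriveB (is_deriveN d2) d4; rewrite /G => h.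
  apply: is_derive_eq.
  have -> : \sum_(i < L) t ^+ i = (1 - t ^+ L) / (1 - t).
    have t1' : 1 - t != 0 by rewrite gt_eqF.
    by apply: (mulIf t1'); rewrite divfK //; have := subrX1 t L; lra.
  by field; rewrite gt_eqF.
have cont : {within `[(0 : R), x], continuous G}.
  by apply: derivable_within_continuous => t tx; have [] := dG t tx.
have [c cx] := @MVT_segment R G _ 0 x x0 (fun t tx => dG t (subset_itv_oo_cc tx)) cont.
have -> : G 0 = 0.
  by rewrite /G subr0 ln1 big1 ?oppr0 ?addr0 // => i _; rewrite expr0n mulr0.
rewrite !subr0.
have -> : G x = - ln (1 - x) - \sum_(l < L) x ^+ l.+1 / l.+1%:R.
  by rewrite /G; congr (_ - _); apply: eq_bigr => l _; rewrite mulrC.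
move: cx; rewrite in_itv /= => /andP[c0 cx] e.
have c1 : 0 < 1 - c by rewrite subr_gt0; lra.
have c2 : 0 <= c ^+ L / (1 - c) by rewrite divr_ge0 ?exprn_ge0 ?(ltW c1).
apply/andP; split; first by rewrite -subr_ge0 e mulr_ge0.
rewrite -lerBlDl e; apply: (@le_trans _ _ (c ^+ L / (1 - c))).
  by rewrite ler_piMr // ltW.
have x2 : 0 < 1 - x by rewrite subr_gt0.
apply: ler_pM; rewrite ?exprn_ge0 ?invr_ge0 ?(ltW c1) //.
  by apply: lerXn2r; rewrite ?nnegrE.
by rewrite lef_pV2 ?posrE //; lra.
Qed.
End LogSeries.

(** * Effect of one more constraint on the logarithm of the number of solutions *)

Section CSP.
Context {R : realType} {T S : finType} (v : T -> S -> bool).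
Implicit Types F : {set T}.

Definition sols F : {set S} := [set s | [forall C in F, ~~ v C s]]%SET.

(* The added 1 is a dummy configuration that no constraint excludes, so that
   [lnZ] stays finite on unsatisfiable F. *)
Definition lnZ F : R := ln (1 + #|sols F|%:R).

Lemma sols_setU1 C F : sols (C |: F) = (sols F :&: [set s | ~~ v C s])%SET.
Proof.
apply/setP => s; rewrite !finset.inE; apply/forall_inP/andP.
  move=> h; split; last by apply: h; rewrite finset.setU11.
  by apply/forall_inP => D DF; apply: h; rewrite finset.in_setU1 DF orbT.
by move=> [/forall_inP h vC] D; rewrite finset.in_setU1 => /predU1P[->|/h].
Qed.

(** The probability that C is violated by a uniform element among the solutions of F and the dummy.
    The dummy keeps it strictly below 1. *)
Definition excl F C : R := #|(sols F :&: [set s | v C s])%SET|%:R / (1 + #|sols F|%:R).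

Lemma excl_bounds F C : 0 <= excl F C <= #|sols F|%:R / (1 + #|sols F|%:R).
Proof.
have Z0 : 0 < 1 + #|sols F|%:R :> R by rewrite ltr_wpDr.
rewrite divr_ge0 ?(ltW Z0) //= ler_pM2r ?invr_gt0 // ler_nat subset_leq_card //.
exact: finset.subsetIl.
Qed.

Lemma lnZ_setU1 F C : lnZ (C |: F) - lnZ F = ln (1 - excl F C).
Proof.
have Z0 : 0 < 1 + #|sols F|%:R :> R by rewrite ltr_wpDr.
rewrite -ln_div ?posrE ?ltr_wpDr //; congr ln.
rewrite sols_setU1 /excl.
have -> : #|sols F| = (#|(sols F :&: [set s | v C s])%SET| +
    #|(sols F :&: [set s | ~~ v C s])%SET|)%N.
  rewrite -(cardsID [set s | v C s]%SET (sols F)); congr (_ + _)%N.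
  by apply: eq_card => s; rewrite !finset.inE andbC.
by rewrite natrD; field; rewrite -natrD gt_eqF // ltr_wpDr.
Qed.

(* The moments of [excl] count l-tuples of solutions (replicas) violating C
   simultaneously. *)
Lemma excl_moment (d : T -> R) (dl : R) F (l : nat) : 0 <= dl ->
  (forall U : {set S}, U != finset.set0 ->
    \sum_(C | [forall s in U, v C s]) d C <= dl) ->
  \sum_C d C * excl F C ^+ l.+1 <=
    dl * (#|sols F|%:R / (1 + #|sols F|%:R)) ^+ l.+1.
Proof.
move=> dl0 H.
have powE (A : {set S}) : #|A|%:R ^+ l.+1 =
    \sum_(f : {ffun 'I_l.+1 -> S}) ([forall i, f i \in A] : nat)%:R :> R.
  have e := @card_ffun_on 'I_l.+1 S (mem A); rewrite card_ord in e.
  rewrite -natrX -e -sum1_card natr_sum big_mkcond; apply: eq_bigr => f _.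
  have -> : (f \in ffun_on (mem A)) = [forall i, f i \in A].
    by apply/ffun_onP/forallP.
  by case: ifP.
under eq_bigr do rewrite /excl exprMn powE mulrA mulr_sumr.
rewrite -mulr_suml exprMn mulrA ler_wpM2r ?exprn_ge0 ?invr_ge0 ?addr_ge0 //.
rewrite powE exchange_big mulr_sumr; apply: ler_sum => f _ /=.
have [fF|fF] := boolP [forall i, f i \in sols F]; last first.
  rewrite mulr0 big1 // => C _; rewrite [X in _ * X%:R](_ : _ = 0%N) ?mulr0 //.
  apply/eqP; rewrite eqb0; apply: contra fF => /forallP h.
  by apply/forallP => i; have := h i; rewrite finset.inE => /andP[].
(* A tuple of replicas matters only through its set of values, which is nonempty because there is at
   least one replica. *)
rewrite mulr1; apply: le_trans (H (f @: [set: 'I_l.+1]%SET) _); last first.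
  by apply/set0Pn; exists (f ord0); apply: imset_f; rewrite finset.inE.
rewrite [leRHS]big_mkcond; apply: ler_sum => C _.
have -> : [forall i, f i \in (sols F :&: [set s | v C s])%SET] =
    [forall s in f @: [set: 'I_l.+1]%SET, v C s].
  apply/forallP/forall_inP => [h s /imsetP[i _ ->]|h i].
    by have := h i; rewrite !finset.inE => /andP[].
  rewrite !finset.inE; have /forallP/(_ i) := fF; rewrite finset.inE => -> /=.
  by apply: h; apply: imset_f; rewrite finset.inE.
by case: ifP; rewrite ?mulr1 ?mulr0.
Qed.

(** Each moment in the expansion of - ln (1 - x) is at most dl times a power of z, the value of
    [excl] for a constraint violated by every solution. Resumming gives dl * - ln (1 - z), and - ln
    (1 - z) is exactly [lnZ F]. As d may take both signs, the series is truncated at L with a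
    remainder bounded in absolute value. *)
Lemma lnZ_setU1_sum (d : T -> R) (dl : R) F : 0 <= dl ->
  (forall U : {set S}, U != finset.set0 ->
    \sum_(C | [forall s in U, v C s]) d C <= dl) ->
  - (dl * lnZ F) <= \sum_C d C * (lnZ (C |: F) - lnZ F).
Proof.
move=> dl0 H; under eq_bigr do rewrite lnZ_setU1.
set Zr : R := #|sols F|%:R; set z := Zr / (1 + Zr).
have Zr0 : 0 <= Zr by [].
have Z1 : 0 < 1 + Zr by rewrite ltr_wpDr.
have z0 : 0 <= z by rewrite divr_ge0 // ltW.
have z1E : 1 - z = (1 + Zr)^-1 by rewrite /z; field; rewrite gt_eqF.
have z1 : z < 1 by rewrite -subr_gt0 z1E invr_gt0.
rewrite lerNl -sumrN.
have -> : dl * lnZ F = dl * - ln (1 - z) by rewrite z1E lnV ?posrE // opprK.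
(* The remainder x^L / (1 - x) is at most z^L (1 + Zr), because 1 - x >= 1 - z = 1 / (1 + Zr). *)
pose K := (\sum_C `|d C|) * (1 + Zr).
have bnd L : \sum_C - (d C * ln (1 - excl F C)) <= dl * - ln (1 - z) + K * z ^+ L.
  have xb C : [/\ 0 <= excl F C, excl F C <= z & excl F C < 1].
    by have /andP[a b] := excl_bounds F C; split => //; apply: le_lt_trans z1.
  have -> : \sum_C - (d C * ln (1 - excl F C)) =
     \sum_C d C * (\sum_(l < L) excl F C ^+ l.+1 / l.+1%:R) +
     \sum_C d C * (- ln (1 - excl F C) - \sum_(l < L) excl F C ^+ l.+1 / l.+1%:R).
    by rewrite -big_split; apply: eq_bigr => C _ /=; ring.
  apply: lerD.
    have /andP[h _] := neg_ln1B_partial L z0 z1.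
    apply: le_trans (ler_wpM2l dl0 h).
    under eq_bigr do rewrite mulr_sumr.
    rewrite exchange_big mulr_sumr; apply: ler_sum => l _ /=.
    under eq_bigr do rewrite mulrA.
    by rewrite -mulr_suml mulrA ler_wpM2r // excl_moment.
  rewrite /K -mulrA mulr_suml; apply: ler_sum => C _.
  have [x0 xz x1] := xb C.
  have /andP[h1 h2] := neg_ln1B_partial L x0 x1.
  rewrite -subr_ge0 in h1; rewrite -lerBlDl in h2.
  apply: le_trans (ler_norm _) _; rewrite normrM ler_wpM2l // ger0_norm //.
  apply: le_trans h2 _; rewrite mulrC.
  have x2 : 0 < 1 - excl F C by rewrite subr_gt0.
  apply: ler_pM; rewrite ?exprn_ge0 ?invr_ge0 ?(ltW x2) //.
    by rewrite -[leRHS]invrK lef_pV2 ?posrE ?invr_gt0 // -z1E; lra.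
  by apply: lerXn2r; rewrite ?nnegrE.
have cv : (fun L => dl * - ln (1 - z) + K * z ^+ L) @ \oo --> dl * - ln (1 - z) + K * 0.
  apply: cvgD; first exact: cvg_cst.
  by apply: cvgMl_tmp; apply: cvg_expr; rewrite ger0_norm.
rewrite mulr0 addr0 in cv.
rewrite -(cvg_lim (@norm_hausdorff _ _) cv).
by apply: limr_ge; [apply: cvgP cv|apply: nearW].
Qed.
End CSP.

(** * Clauses violated by every assignment of a set *)

Section ClauseCounting.
Variables (k n : nat).
Implicit Types (s : assignment n) (U : {set assignment n}).

Definition violates s (C : kclause k n) : bool :=
  ~~ [exists l in val C, s l.1 == l.2].

Lemma satisfiesE s (F : formula k n) :
  satisfies s F = [forall C in F, ~~ violates s C].
Proof. by apply: eq_forallb => C; rewrite negbK. Qed.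

Lemma card_assignment : #|{: assignment n}| = (2 ^ n)%N.
Proof. by rewrite card_ffun card_bool card_ord. Qed.

Lemma Z_le (F : formula k n) : (Z F <= 2 ^ n)%N.
Proof. by rewrite -card_assignment max_card. Qed.

(* The literals violated by every assignment of U; any k of them form a clause. *)
Definition frozen U : {set literal n} :=
  [set l : literal n | [forall s in U, s l.1 != l.2]]%SET.

(** A single assignment violates exactly one of the two literals of each variable. Hence any k
    frozen literals involve k distinct variables. *)
Lemma frozen_inj U : U != finset.set0 -> {in frozen U &, injective fst}.
Proof.
move=> /set0Pn[s sU] [i b] [j c]; rewrite !finset.inE /=.
move=> /forall_inP/(_ s sU) /= + /forall_inP/(_ s sU) /= + ij; rewrite -ij => h1 h2.
by congr (_, _); move: h1 h2; case: (s i); case: b; case: c.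
Qed.

Lemma card_frozen_le U : U != finset.set0 -> (#|frozen U| <= n)%N.
Proof.
move=> U0; rewrite -(card_in_imset (frozen_inj U0)) -[leqRHS]card_ord.
exact: max_card.
Qed.

Lemma card_all_violated U : U != finset.set0 ->
  #|[set C : kclause k n | [forall s in U, violates s C]]%SET| =
    'C(#|frozen U|, k).
Proof.
move=> U0; rewrite -cards_draws -(card_imset _ val_inj).
apply: eq_card => B; rewrite !finset.inE; apply/imsetP/andP.
  move=> [C]; rewrite finset.inE => /forall_inP h ->; split; last first.
    by have /andP[] := valP C.
  apply/fintype.subsetP => l lC; rewrite finset.inE; apply/forall_inP => s sU.
  by have := h _ sU; rewrite /violates negb_exists_in => /forall_inP; apply.
move=> [Bf Bk]; have kB : is_kclause k B.
  rewrite /is_kclause Bk /= card_in_imset // => x y xB yB.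
  by apply: (frozen_inj U0); apply: (fintype.subsetP Bf).
exists (exist _ B kB) => //; rewrite finset.inE; apply/forall_inP => s sU.
rewrite /violates negb_exists_in; apply/forall_inP => l /= lB.
by have := fintype.subsetP Bf _ lB; rewrite finset.inE => /forall_inP; apply.
Qed.
End ClauseCounting.

(** * Splitting the variables into two blocks *)

Section Split.
Variables (n1 n2 : nat).
Implicit Types (s : assignment (n1 + n2)).

Definition lpart s : assignment n1 := [ffun i => s (lshift n2 i)].
Definition rpart s : assignment n2 := [ffun i => s (rshift n1 i)].

Definition split_assignment s : assignment n1 * assignment n2 := (lpart s, rpart s).

Lemma split_assignment_bij : bijective split_assignment.
Proof.
pose g (p : assignment n1 * assignment n2) : assignment (n1 + n2) :=
  [ffun i => match fintype.split i with inl j => p.1 j | inr j => p.2 j end].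
exists g => [s|[s1 s2]].
  apply/ffunP => i; rewrite ffunE /=.
  by case: (fintype.splitP i) => j e; rewrite ffunE; congr (s _); apply: val_inj.
congr (_, _); apply/ffunP => i; rewrite !ffunE.
  by rewrite -[lshift n2 i]/(unsplit (inl i)) unsplitK.
by rewrite -[rshift n1 i]/(unsplit (inr i)) unsplitK.
Qed.

Lemma card_frozen_split (U : {set assignment (n1 + n2)}) :
  #|frozen U| = (#|frozen (lpart @: U)| + #|frozen (rpart @: U)|)%N.
Proof.
have E n (V : {set assignment n}) : #|frozen V| =
    (\sum_(i < n) \sum_(b : bool) [forall s in V, s i != b])%N.
  rewrite pair_big /= -sum1dep_card big_mkcond /=.
  by apply: eq_bigr => -[i b] _ /=; case: ifP.
have im n (h : assignment (n1 + n2) -> assignment n) i b :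
    [forall s in h @: U, s i != b] = [forall s in U, h s i != b].
  apply/forall_inP/forall_inP => [a s sU|a _ /imsetP[s sU ->]]; last exact: a.
  by apply: a; apply: imset_f.
rewrite !E big_split_ord /=; congr (_ + _)%N;
  apply: eq_bigr => i _; apply: eq_bigr => b _; rewrite im;
  by congr (nat_of_bool _); apply: eq_forallb => s; rewrite ffunE.
Qed.
End Split.

(** * Interpolation between one formula and two independent blocks *)

Section Interpolation.
Context {R : realType}.
Variables (k n1 n2 : nat).

Lemma ln_1D_le n m : (m <= 2 ^ n)%N -> ln (1 + m%:R : R) <= n.+1%:R * ln 2.
Proof.
move=> mn; rewrite -ln_powR powR_mulrn // ler_ln ?posrE ?ltr_wpDr // ?exprn_gt0 //.
rewrite -natrX -(natrD _ 1) ler_nat expnS mul2n -addnn leq_add // expn_gt0 //.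
Qed.

(** For a, b >= 1, 2 (1 + a b) - (1 + a) (1 + b) = (a - 1) (b - 1) >= 0. If a or b vanishes, the
    penalty with factor n + 1 exceeds whatever logarithm remains. *)
Lemma ln_1DM n a b : (a <= 2 ^ n)%N -> (b <= 2 ^ n)%N ->
  ln (1 + a%:R) + ln (1 + b%:R) - ln 2 - n.+1%:R * ln 2 * ((a == 0%N)%:R + (b == 0%N)%:R)
    <= ln (1 + (a * b)%N%:R) :> R.
Proof.
move=> an bn; have la := ln_1D_le an; have lb := ln_1D_le bn.
have l2 : 0 < ln (2 : R) by rewrite ln_gt0 // ltr1n.
have nl2 : 0 <= n.+1%:R * ln (2 : R) by rewrite mulr_ge0 // ltW.
have [a0|a0] := eqVneq a 0%N.
  rewrite a0 mul0n addr0 ln1 /=; case: (b == 0%N) => /=; lra.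
have [b0|b0] := eqVneq b 0%N.
  rewrite b0 muln0 addr0 ln1 /=; lra.
rewrite /= addr0 mulr0 subr0 lerBlDr -lnM ?posrE ?ltr_wpDr //.
rewrite -lnM ?posrE ?ltr_wpDr // ler_ln ?posrE ?mulr_gt0 ?ltr_wpDr //.
have a1 : 1 <= a%:R :> R by rewrite ler1n lt0n.
have b1 : 1 <= b%:R :> R by rewrite ler1n lt0n.
by rewrite natrM; nra.
Qed.

(** The large formula and the two block formulas share one index set, so that a single product
    measure moves from one to the others by changing rates. *)
Definition both_clauses := (kclause k (n1 + n2) + (kclause k n1 + kclause k n2))%type.

Definition both_violates (C : both_clauses) (s : assignment (n1 + n2)) : bool :=
  match C with
  | inl C => violates s C
  | inr (inl C) => violates (lpart s) C
  | inr (inr C) => violates (rpart s) C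
  end.

Lemma card_sols_le (F : {set both_clauses}) :
  (#|sols both_violates F| <= Z (inl @^-1: F))%N.
Proof.
rewrite /Z; apply: subset_leq_card; apply/fintype.subsetP => s.
rewrite finset.inE => /forall_inP h.
rewrite finset.inE satisfiesE; apply/forall_inP => C.
by rewrite finset.inE => /h.
Qed.

Lemma card_sols_split (F : {set both_clauses}) : (forall C, inl C \notin F) ->
  #|sols both_violates F| =
    (Z ((inr \o inl) @^-1: F) * Z ((inr \o inr) @^-1: F))%N.
Proof.
move=> F0; set F1 := _ @^-1: _; set F2 := _ @^-1: _.
have <- : #|finset.setX [set s | satisfies s F1]%SET [set s | satisfies s F2]%SET| =
    (Z F1 * Z F2)%N by rewrite cardsX !cardsE.
rewrite -(on_card_preimset (f := @split_assignment n1 n2)); last first.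
  exact: onW_bij (split_assignment_bij n1 n2).
apply: eq_card => s; rewrite !finset.inE /= !satisfiesE.
apply/forall_inP/andP => [h|[/forall_inP h1 /forall_inP h2]].
  by split; apply/forall_inP => C; rewrite finset.inE => /h.
move=> [C|[C|C]] CF.
- by have := F0 C; rewrite CF.
- by apply: h1; rewrite finset.inE.
- by apply: h2; rewrite finset.inE.
Qed.

Definition expect_lnZ (n : nat) (p : R) : R :=
  expect (fun=> p) (fun F : formula k n => ln (1 + (Z F)%:R)).

Definition unsat (n : nat) (p : R) : R :=
  expect (fun=> p) (fun F : formula k n => (Z F == 0%N)%:R).

Lemma expect_lnZ_split (r r1 r2 dl : R) :
  0 <= r -> 0 <= r1 -> 0 <= r2 -> 0 <= dl ->
  (forall a1 a2, (a1 <= n1)%N -> (a2 <= n2)%N ->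
     r * 'C(a1 + a2, k)%:R <= r1 * 'C(a1, k)%:R + r2 * 'C(a2, k)%:R + dl) ->
  expect_lnZ n1 (1 - expR (- r1)) + expect_lnZ n2 (1 - expR (- r2)) - ln 2
    - (n1 + n2).+1%:R * ln 2 *
        (unsat n1 (1 - expR (- r1)) + unsat n2 (1 - expR (- r2)) + dl)
  <= expect_lnZ (n1 + n2) (1 - expR (- r)).
Proof.
move=> r0 r10 r20 dl0 H.
pose l (C : both_clauses) := if C is inl _ then r else 0.
pose m (C : both_clauses) :=
  match C with inl _ => 0 | inr (inl _) => r1 | inr (inr _) => r2 end.
pose f (F : {set both_clauses}) : R := lnZ both_violates F.
set L : R := (n1 + n2).+1%:R * ln 2.
have l20 : 0 <= ln (2 : R) by rewrite ln_ge0 // ler1n.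
have fL F : f F <= L.
  by apply: ln_1D_le; rewrite -(card_assignment (n1 + n2)) max_card.
have l0 C : 0 <= l C by case: C.
have m0 C : 0 <= m C by case: C => [//|[]].
have step F : - (dl * L) <= \sum_C (l C - m C) * (f (C |: F) - f F).
  apply: (@le_trans _ _ (- (dl * f F))); first by rewrite lerN2 ler_wpM2l.
  apply: lnZ_setU1_sum => // U U0.
  have [U1 U2] : @lpart n1 n2 @: U != finset.set0 /\ @rpart n1 n2 @: U != finset.set0.
    by rewrite !imset_eq0.
  rewrite !big_sumType /=.
  under eq_bigr do rewrite subr0.
  under [X in _ + (X + _)]eq_bigr do rewrite sub0r.
  under [X in _ + (_ + X)]eq_bigr do rewrite sub0r.
  have im n (h : assignment (n1 + n2) -> assignment n) (C : kclause k n) :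
      [forall s in U, violates (h s) C] = [forall s in h @: U, violates s C].
    apply/forall_inP/forall_inP => [a _ /imsetP[s sU ->]|a s sU]; first exact: a.
    by apply: a; apply: imset_f.
  rewrite (eq_bigl _ _ (im _ (@lpart n1 n2))) (eq_bigl _ _ (im _ (@rpart n1 n2))).
  have cnt n (V : {set assignment n}) (c : R) : V != finset.set0 ->
      \sum_(C : kclause k n | [forall s in V, violates s C]) c = c * 'C(#|frozen V|, k)%:R.
    by move=> V0; rewrite sumr_const -card_all_violated // cardsE mulr_natr.
  rewrite !cnt // card_frozen_split.
  have := H _ _ (card_frozen_le U1) (card_frozen_le U2); lra.
have I := interpolation l0 m0 step.
have upper : expect (rate_pr l) f <= expect_lnZ (n1 + n2) (1 - expR (- r)).
  have -> : expect_lnZ (n1 + n2) (1 - expR (- r)) =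
      expect (rate_pr l) (fun F => ln (1 + (Z (inl @^-1: F))%:R)).
    rewrite (expect_marginal (h := inl) (rate_pr l)
      (fun F : formula k (n1 + n2) => ln (1 + (Z F)%:R))) //; first by move=> x y [].
  apply: le_expect => [|F _]; first exact: rate_pr01.
  rewrite ler_ln ?posrE ?ltr_wpDr // lerD2l ler_nat; exact: card_sols_le.
have lower : expect_lnZ n1 (1 - expR (- r1)) + expect_lnZ n2 (1 - expR (- r2))
    - ln 2 - L * (unsat n1 (1 - expR (- r1)) + unsat n2 (1 - expR (- r2))) <=
    expect (rate_pr m) f.
  have M1 g : expect (rate_pr m) (fun F => g ((inr \o inl) @^-1: F)) =
      expect (fun=> 1 - expR (- r1)) (g : formula k n1 -> R).
    by rewrite (expect_marginal (h := inr \o inl)) // => x y [].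
  have M2 g : expect (rate_pr m) (fun F => g ((inr \o inr) @^-1: F)) =
      expect (fun=> 1 - expR (- r2)) (g : formula k n2 -> R).
    by rewrite (expect_marginal (h := inr \o inr)) // => x y [].
  rewrite /expect_lnZ /unsat -!M1 -!M2 -!expectD -expectZ.
  rewrite -[X in _ - X - _](expect_cst (rate_pr m)) -!expectB.
  apply: le_expect => [|F nz]; first exact: rate_pr01.
  rewrite /f /lnZ card_sols_split.
    apply: ln_1DM; apply: leq_trans (Z_le _) _; rewrite leq_exp2l ?leq_addr ?leq_addl //.
  by move=> C; apply/negP => /nz; rewrite /rate_pr /= oppr0 expR0 subrr eqxx.
by move: I upper lower; rewrite /L; lra.
Qed.
End Interpolation.

(** * Binomial ratios compared with powers *)

Section BinomialRatio.

Lemma ffact_mul_exp_le (a n k : nat) : (a <= n)%N -> (a ^_ k * n ^ k <= a ^ k * n ^_ k)%N.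
Proof.
move=> an; elim: k => [|k IH]; first by rewrite !ffactn0 !expn0.
rewrite !ffactnSr !expnSr mulnACA [leqRHS]mulnACA leq_mul //.
by rewrite mulnBl mulnBr leq_sub2l // mulnC leq_mul2l an orbT.
Qed.

Lemma ffact_le_expn (c k : nat) : (c ^_ k <= c ^ k)%N.
Proof.
elim: k => [|k IH]; first by rewrite ffactn0 expn0.
by rewrite ffactnSr expnSr leq_mul ?leq_subr.
Qed.

(** Replacing a factor c - j by c costs at most j times the lower power of c, and j^2 + j <= (j +
    1)^2 closes the induction. *)
Lemma expn_le_ffact (c k : nat) : (c ^ k.+1 <= c ^_ k.+1 + k.+1 ^ 2 * c ^ k)%N.
Proof.
elim: k => [|k IH]; first by rewrite ffactn1 expn1 leq_addr.
have h := ffact_le_expn c k.+1.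
rewrite expnS ffactnSr.
have : (c * c ^ k.+1 <= c * c ^_ k.+1 + k.+1 ^ 2 * c ^ k.+1)%N.
  by have := leq_mul (leqnn c) IH; rewrite mulnDr (mulnCA c (k.+1 ^ 2)%N) -(expnS c k).
move: (c ^_ k.+1) (c ^ k.+1)%N h => F E FE; move: k.+1 => j; move=> h.
have : (c * F <= F * (c - j) + j * E)%N by nia.
by rewrite -[j.+1]addn1; nia.
Qed.

Context {R : realType}.

Lemma bin_ffactR (a k : nat) : 'C(a, k)%:R = (a ^_ k)%:R / k`!%:R :> R.
Proof.
by rewrite -bin_ffact natrM mulfK // pnatr_eq0 -lt0n fact_gt0.
Qed.

Lemma bin_ratio_ffact (a n k : nat) : 
  'C(a, k)%:R / 'C(n, k)%:R = (a ^_ k)%:R / (n ^_ k)%:R :> R.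
Proof.
have k0 : k`!%:R != 0 :> R by rewrite pnatr_eq0 -lt0n fact_gt0.
by rewrite !bin_ffactR invf_div mulrA divfK.
Qed.

Lemma bin_ratio_le (a n k : nat) : (a <= n)%N -> (k <= n)%N ->
  'C(a, k)%:R / 'C(n, k)%:R <= (a%:R / n%:R) ^+ k :> R.
Proof.
move=> an kn; have [->|k0] := posnP k; first by rewrite !bin0 divr1 expr0.
have n0 : (0 < n)%N by lia.
rewrite bin_ratio_ffact expr_div_n ler_pdivrMr ?ltr0n ?ffact_gt0 //.
rewrite mulrAC ler_pdivlMr ?exprn_gt0 ?ltr0n //.
by rewrite -!natrX -!natrM ler_nat ffact_mul_exp_le.
Qed.

Lemma bin_ratio_ge (c m k : nat) (e : R) : (c <= m)%N -> (k <= m)%N -> (2 <= k)%N ->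
  0 < e <= 1 ->
  m%:R * (c%:R / m%:R) ^+ k * (1 - (k ^ 2)%:R / (e * m%:R)) - (k ^ 2)%:R * e
    <= m%:R * ('C(c, k)%:R / 'C(m, k)%:R) :> R.
Proof.
move=> cm km k2 /andP[e0 e1].
have mN : (0 < m)%N by lia.
have m0 : 0 < m%:R :> R by rewrite ltr0n.
pose x : R := c%:R / m%:R.
have x0 : 0 <= x by rewrite divr_ge0.
have x1 : x <= 1 by rewrite /x ler_pdivrMr // mul1r ler_nat.
case: k k2 km => [//|k]; rewrite ltnS => k1 km; set K : R := (k.+1 ^ 2)%:R.
have K0 : 0 <= K by [].
have h1 : x ^+ k.+1 - K * x ^+ k / m%:R <= 'C(c, k.+1)%:R / 'C(m, k.+1)%:R.
  rewrite bin_ratio_ffact.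
  apply: (@le_trans _ _ ((c ^_ k.+1)%:R / m%:R ^+ k.+1)); last first.
    rewrite ler_wpM2l // lef_pV2 ?posrE ?exprn_gt0 ?ltr0n ?ffact_gt0 //.
    by rewrite -natrX ler_nat ffact_le_expn.
  rewrite lerBlDr /x !expr_div_n.
  have -> : K * (c%:R ^+ k / m%:R ^+ k) / m%:R = K * c%:R ^+ k / m%:R ^+ k.+1.
    by rewrite exprSr invfM !mulrA.
  rewrite -mulrDl ler_wpM2r ?invr_ge0 ?exprn_ge0 //.
  by rewrite /K -!natrX -natrM -natrD ler_nat expn_le_ffact.
have h2 : x ^+ k <= x ^+ k.+1 / e + e.
  have [ex|xe] := leP e x.
    apply: (@le_trans _ _ (x ^+ k.+1 / e)); last by rewrite lerDl ltW.
    by rewrite ler_pdivlMr // exprSr ler_wpM2l // exprn_ge0.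
  apply: (@le_trans _ _ e); last by rewrite lerDr divr_ge0 ?exprn_ge0 // ltW.
  apply: le_trans (ltW xe); case: k k1 {km K K0 h1} => [//|k] _.
  by rewrite exprS ler_piMr // exprn_ile1.
rewrite -/x.
have h1' := ler_wpM2l (ltW m0) h1; apply: le_trans h1'.
have h2' := ler_wpM2l K0 h2.
have -> : m%:R * (x ^+ k.+1 - K * x ^+ k / m%:R) = m%:R * x ^+ k.+1 - K * x ^+ k.
  by field; rewrite gt_eqF.
have -> : m%:R * x ^+ k.+1 * (1 - K / (e * m%:R)) = m%:R * x ^+ k.+1 - K * (x ^+ k.+1 / e).
  by field; rewrite !gt_eqF.
lra.
Qed.

Lemma convex_expr (u w x y : R) (k : nat) : 0 <= u -> 0 <= w -> u + w = 1 ->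
  0 <= x -> 0 <= y -> (u * x + w * y) ^+ k <= u * x ^+ k + w * y ^+ k.
Proof.
move=> u0 w0 uw x0 y0; elim: k => [|k IH]; first by rewrite !expr0 !mulr1 uw.
have z0 : 0 <= u * x + w * y by rewrite addr_ge0 // mulr_ge0.
rewrite exprS; apply: le_trans (ler_wpM2l z0 IH) _.
(* Multiplied by u w, this is exactly the gap left after the induction hypothesis. *)
have xy : 0 <= (x ^+ k - y ^+ k) * (x - y).
  have [xy|/ltW xy] := leP x y.
    by rewrite -mulrNN mulr_ge0 // oppr_ge0 subr_le0 // lerXn2r ?nnegrE.
  by rewrite mulr_ge0 // subr_ge0 // lerXn2r ?nnegrE.
have := mulr_ge0 (mulr_ge0 u0 w0) xy.
rewrite !exprS -subr_ge0 => h; rewrite -subr_ge0.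
have wE : w = 1 - u by rewrite -uw; ring.
by apply: le_trans h _; rewrite wE le_eqVlt; apply/orP; left; apply/eqP; ring.
Qed.

(** Convexity of x^k is applied at a1 / n1 and a2 / n2 with weights proportional to n1 and n2. The
    factor 1 - eta pays for the relative losses of [bin_ratio_ge] in both blocks, and the two
    additive losses give the last term. *)
Lemma split_bin_ratio (n1 n2 a1 a2 k : nat) (e eta : R) :
  (2 <= k)%N -> (k <= n1)%N -> (k <= n2)%N -> (a1 <= n1)%N -> (a2 <= n2)%N ->
  0 < e <= 1 -> eta <= 1 ->
  (k ^ 2)%:R / (e * n1%:R) <= eta -> (k ^ 2)%:R / (e * n2%:R) <= eta ->
  (1 - eta) * ((n1 + n2)%:R * ('C(a1 + a2, k)%:R / 'C(n1 + n2, k)%:R)) <=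
  n1%:R * ('C(a1, k)%:R / 'C(n1, k)%:R) + n2%:R * ('C(a2, k)%:R / 'C(n2, k)%:R)
   + 2 * (k ^ 2)%:R * e :> R.
Proof.
move=> k2 k1n k2n a1n a2n e01 eta1 en1 en2.
have n10 : 0 < n1%:R :> R by rewrite ltr0n; lia.
have n20 : 0 < n2%:R :> R by rewrite ltr0n; lia.
have n0 : 0 < n1%:R + n2%:R :> R by rewrite addr_gt0.
have h1 := bin_ratio_ge a1n k1n k2 e01.
have h2 := bin_ratio_ge a2n k2n k2 e01.
have h := @bin_ratio_le (a1 + a2) (n1 + n2) k (leq_add a1n a2n) (leq_trans k1n (leq_addr _ _)).
set x1 : R := a1%:R / n1%:R in h1; set x2 : R := a2%:R / n2%:R in h2.
have x10 : 0 <= x1 by rewrite divr_ge0.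
have x20 : 0 <= x2 by rewrite divr_ge0.
have u0 : 0 <= n1%:R / (n1%:R + n2%:R) :> R by rewrite divr_ge0 // ltW.
have w0 : 0 <= n2%:R / (n1%:R + n2%:R) :> R by rewrite divr_ge0 // ltW.
have uw : n1%:R / (n1%:R + n2%:R) + n2%:R / (n1%:R + n2%:R) = 1 :> R.
  by field; rewrite gt_eqF.
have c : (n1%:R + n2%:R) * ((a1 + a2)%:R / (n1 + n2)%:R) ^+ k <=
    n1%:R * x1 ^+ k + n2%:R * x2 ^+ k.
  have -> : (a1 + a2)%:R / (n1 + n2)%:R =
      n1%:R / (n1%:R + n2%:R) * x1 + n2%:R / (n1%:R + n2%:R) * x2 :> R.
    by rewrite !natrD /x1 /x2; field; rewrite !gt_eqF.
  rewrite mulrC -ler_pdivlMr //; apply: le_trans (convex_expr k u0 w0 uw x10 x20) _.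
  by rewrite [leRHS]mulrDl !(mulrAC _ _^-1).
have X10 : 0 <= n1%:R * x1 ^+ k by rewrite mulr_ge0 ?exprn_ge0.
have X20 : 0 <= n2%:R * x2 ^+ k by rewrite mulr_ge0 ?exprn_ge0.
have eta0 : 0 <= 1 - eta by rewrite subr_ge0.
have nn : 0 <= (n1 + n2)%:R :> R by [].
rewrite -natrD in c.
apply: le_trans (ler_wpM2l eta0 (le_trans (ler_wpM2l nn h) c)) _.
have y1 : n1%:R * x1 ^+ k * (1 - eta) <= n1%:R * x1 ^+ k * (1 - (k ^ 2)%:R / (e * n1%:R)).
  by rewrite ler_wpM2l // lerD2l lerN2.
have y2 : n2%:R * x2 ^+ k * (1 - eta) <= n2%:R * x2 ^+ k * (1 - (k ^ 2)%:R / (e * n2%:R)).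
  by rewrite ler_wpM2l // lerD2l lerN2.
rewrite mulrC mulrDl; lra.
Qed.
End BinomialRatio.

(** * Approximate superadditivity of the expected logarithm *)

Section Superadditivity.
Context {R : realType}.

Lemma ln2_bounds : 0 < ln (2 : R) <= 1.
Proof.
rewrite ln_gt0 ?ltr1n //=; have := @le_ln1Dx R 1; rewrite -[1 + 1]/(2%:R).
by apply; lra.
Qed.

Lemma expR_le_1D2x (y : R) : 0 <= y <= 2^-1 -> expR y - 1 <= 2 * y.
Proof.
move=> /andP[y0 y1]; have h := expR_ge1Dx (- y).
have p : 0 < 1 - y by lra.
have : expR y * (1 - y) <= 1.
  by apply: le_trans (ler_wpM2l (expR_ge0 y) h) _; rewrite expRxMexpNx_1.
by rewrite -ler_pdivlMr // => /le_trans ee; rewrite lerBlDr; apply: ee; rewrite ler_pdivrMr //; nra.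
Qed.

(** Each factor of the chi-square product is at most 1 + 8 eta^2 p, because 1 - p >= 1 / 2. The
    product is thus at most e^y with y = 8 eta^2 p #|T| <= 1 / 2, and e^y - 1 <= 2 y. *)
Lemma expect_cst_chi2 (T : finType) (f : {set T} -> R) (M p q eta t : R) :
  0 < p <= 2^-1 -> `|q - p| <= 2 * eta * p -> 0 < t -> (forall F, `|f F| <= M) ->
  8 * eta ^+ 2 * p * #|T|%:R <= 2^-1 ->
  `|expect (fun=> q) f - expect (fun=> p) f| <=
     M / 2 * (t * (16 * eta ^+ 2 * p * #|T|%:R) + t^-1).
Proof.
move=> /andP[p0 p1] qp t0 fM small.
have M0 : 0 <= M by apply: le_trans (fM finset.set0).
have q0 : 0 < 1 - p by lra.
have q1 : 1 <= 2 * (1 - p) by lra.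
have p01 (C : T) : 0 < (fun=> p) C < 1 by rewrite p0 /=; lra.
apply: le_trans (expect_chi2 (fun=> q) p01 t0 fM) _.
rewrite ler_wpM2l ?divr_ge0 // lerD2r ler_wpM2l ?(ltW t0) //.
rewrite prodr_const -[#|_|]/(#|T|).
set y := 8 * eta ^+ 2 * p * #|T|%:R in small *.
have y0 : 0 <= y.
  rewrite /y mulr_ge0 ?ler0n // mulr_ge0 ?(ltW p0) //.
  by rewrite mulr_ge0 ?sqr_ge0.
apply: (@le_trans _ _ (2 * y)); last by rewrite /y le_eqVlt; apply/orP; left; apply/eqP; ring.
apply: le_trans (expR_le_1D2x _); last by rewrite y0.
rewrite lerD2r /y [_ * #|T|%:R]mulrC expRM_natl.
have -> : q ^+ 2 / p + (1 - q) ^+ 2 / (1 - p) = 1 + (q - p) ^+ 2 / (p * (1 - p)).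
  by field; rewrite !gt_eqF.
have pp : 0 < p * (1 - p) by rewrite mulr_gt0.
have h1 : 0 <= (q - p) ^+ 2 / (p * (1 - p)) by rewrite divr_ge0 ?sqr_ge0 // ltW.
apply: lerXn2r; rewrite ?nnegrE ?expR_ge0 //; first by rewrite addr_ge0.
apply: le_trans (expR_ge1Dx _); rewrite lerD2l ler_pdivrMr //.
have : (q - p) ^+ 2 <= (2 * eta * p) ^+ 2.
  by rewrite -(real_normK (num_real (q - p))); apply: lerXn2r; rewrite ?nnegrE // (le_trans _ qp).
move=> /le_trans; apply.
have -> : 8 * eta ^+ 2 * p * (p * (1 - p)) = (2 * eta * p) ^+ 2 * (2 * (1 - p)) by ring.
by rewrite ler_peMr ?sqr_ge0.
Qed.

(** Thinning moves p by eta p to r, and turning the rate r into a probability moves it by at most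
    r^2 <= eta p. *)
Lemma rate_pr_shrink (p eta : R) : 0 <= p -> p <= eta -> eta <= 1 ->
  `|1 - expR (- ((1 - eta) * p)) - p| <= 2 * eta * p.
Proof.
move=> p0 pe e1; have e0 : 0 <= eta := le_trans p0 pe.
set r := (1 - eta) * p.
have r0 : 0 <= r by rewrite mulr_ge0 // subr_ge0.
have ep : 0 <= eta * p by rewrite mulr_ge0.
have rE : r = p - eta * p by rewrite /r; ring.
have q1 := expR_ge1Dx (- r).
have q2 : expR (- r) <= 1 - r + r ^+ 2.
  have r1 : 0 < 1 + r by rewrite ltr_wpDr.
  rewrite -(ler_pM2r r1); apply: le_trans (ler_wpM2l (expR_ge0 _) (expR_ge1Dx r)) _.
  rewrite mulrC expRxMexpNx_1; have := exprn_ge0 3 r0; rewrite !exprS expr0; lra.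
have rr : r ^+ 2 <= eta * p.
  by rewrite expr2; apply: ler_pM => //; rewrite rE; lra.
by rewrite ler_norml; apply/andP; split; lra.
Qed.

Variables (k : nat) (alpha : R).
Hypotheses (k2 : (2 <= k)%N) (alpha0 : 0 <= alpha).
Let K : R := (k ^ 2)%:R.

Lemma num_kclauses_gt0 n : (k <= n)%N -> 0 < (num_kclauses k n)%:R :> R.
Proof. by move=> kn; rewrite ltr0n muln_gt0 bin_gt0 kn expn_gt0. Qed.

(** From 1 / 'C(n, k) <= (k / n)^k <= (k / n)^2, the factor 2^k being bounded below by 1. *)
Lemma clause_density_le n : (k <= n)%N ->
  alpha * n%:R / (num_kclauses k n)%:R <= alpha * K / n%:R.
Proof.
move=> kn; have n0 : 0 < n%:R :> R by rewrite ltr0n; lia.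
have c0 : 0 < 'C(n, k)%:R :> R by rewrite ltr0n bin_gt0.
have h := @bin_ratio_le R k n k kn kn.
have k1 : (k%:R / n%:R) ^+ k <= (k%:R / n%:R) ^+ 2 :> R.
  by rewrite ler_wiXn2l // ?divr_ge0 // ler_pdivrMr // mul1r ler_nat.
have {k1}h := le_trans h k1; rewrite binn in h.
have -> : alpha * K / n%:R = alpha * n%:R * (k%:R / n%:R) ^+ 2.
  by rewrite /K natrX; field; rewrite gt_eqF.
rewrite -mulrA -[leRHS]mulrA ler_wpM2l // ler_wpM2l //; apply: le_trans h.
rewrite mul1r lef_pV2 ?posrE ?num_kclauses_gt0 // ler_nat leq_pmulr // expn_gt0 //.
Qed.

Lemma clause_prE n : (k <= n)%N -> alpha * K <= n%:R ->
  clause_pr k n alpha = alpha * n%:R / (num_kclauses k n)%:R.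
Proof.
move=> kn aK; rewrite /clause_pr; apply/min_idPr.
apply: le_trans (clause_density_le kn) _.
by rewrite ler_pdivrMr ?mul1r // ltr0n; lia.
Qed.

Let g n := expect_lnZ k n (clause_pr k n alpha).
Let u n := unsat k n (clause_pr k n alpha).

Lemma unsat_ge0 n p : 0 <= p <= 1 -> 0 <= unsat k n p :> R.
Proof.
move=> p01; rewrite -[leLHS](@expect_cst _ (kclause k n) (fun=> p)).
by apply: le_expect.
Qed.

Lemma clause_pr01 n (a : R) : 0 <= a -> 0 <= clause_pr k n a <= 1.
Proof.
move=> a0; rewrite /clause_pr ge_min lexx /= le_min ler01 /=.
by rewrite divr_ge0 ?mulr_ge0.
Qed.

(** This is the cost of thinning. With s = n^(1/4) and eta of order s^(-3), the chi-square quantity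
    eta^2 p N is of order s^(-2), while the logarithm is at most n + 1, so the change is O(n /
    s). *)
Lemma expect_lnZ_rate (n : nat) (s eta p : R) :
  p = alpha * n%:R / (num_kclauses k n)%:R ->
  (k <= n)%N -> 0 < s -> s ^+ 4 = n%:R -> eta = 4 * K / s ^+ 3 ->
  256 * (K ^+ 2 * alpha) <= s ^+ 2 ->
  p <= 2^-1 -> p <= eta -> eta <= 1 ->
  `|expect_lnZ k n (1 - expR (- ((1 - eta) * p))) - expect_lnZ k n p| <=
    (128 * K ^+ 2 * alpha + 2^-1) * (n.+1%:R / s).
Proof.
move=> pE kn s0 s4 etaE small ph peta eta1.
have K20 : 0 <= K ^+ 2 * alpha by rewrite mulr_ge0 ?sqr_ge0.
have ns0 : 0 <= n.+1%:R / s by rewrite divr_ge0 // ltW.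
have p0 : 0 <= p by rewrite pE divr_ge0 // mulr_ge0.
have [pz|pn] := eqVneq p 0.
  by rewrite pz mulr0 oppr0 expR0 subrr subrr normr0 mulr_ge0 //; lra.
have pp : 0 < p by rewrite lt_neqAle eq_sym pn.
have qp := rate_pr_shrink p0 peta eta1.
have pN : p * (num_kclauses k n)%:R = alpha * s ^+ 4.
  by rewrite pE s4 divfK // gt_eqF // num_kclauses_gt0.
have epN : eta ^+ 2 * p * (num_kclauses k n)%:R = 16 * (K ^+ 2 * alpha) / s ^+ 2.
  by rewrite -mulrA pN etaE; field; rewrite gt_eqF.
have fN (F : formula k n) : `|ln (1 + (Z F)%:R : R)| <= n.+1%:R.
  rewrite ger0_norm ?ln_ge0 ?lerDl //; apply: le_trans (ln_1D_le (Z_le F)) _.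
  by have /andP[_ h] := ln2_bounds; rewrite ler_piMr.
have p12 : 0 < p <= 2^-1 by rewrite pp.
have s20 : 0 < s ^+ 2 by rewrite exprn_gt0.
have sm : 8 * eta ^+ 2 * p * #|{: kclause k n}|%:R <= 2^-1.
  rewrite card_kclause; have -> : 8 * eta ^+ 2 * p * (num_kclauses k n)%:R =
    8 * (eta ^+ 2 * p * (num_kclauses k n)%:R) by ring.
  by rewrite epN !mulrA ler_pdivrMr //; lra.
(* The choice t = s makes both terms of the bound of order 1 / s. *)
apply: le_trans (expect_cst_chi2 p12 qp s0 fN sm) _.
rewrite card_kclause; have -> : 16 * eta ^+ 2 * p * (num_kclauses k n)%:R =
  16 * (eta ^+ 2 * p * (num_kclauses k n)%:R) by ring.
rewrite epN le_eqVlt; apply/orP; left; apply/eqP.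
by field; rewrite gt_eqF.
Qed.

(** With n = n1 + n2 and s = n^(1/4), the additive defect of the binomial comparison is of order 1 /
    s and is multiplied by n + 1; thinning costs n / s as well. Apart from the unsatisfiability
    terms, every error is therefore O(n^(3/4)). *)
Lemma expect_lnZ_superadd (n1 n2 : nat) (s : R) :
  256 * K ^+ 2 * (1 + alpha) <= s -> s ^+ 4 = (n1 + n2)%:R ->
  (n1 + n2 <= 4 * n1)%N -> (n1 + n2 <= 4 * n2)%N ->
  g n1 + g n2 - (n1 + n2).+1%:R * (u n1 + u n2)
    - (2 * alpha * K + 128 * K ^+ 2 * alpha + 2) * (n1 + n2).+1%:R / s
    <= g (n1 + n2).
Proof.
move=> sA s4 n41 n42.
have K4 : 4 <= K by rewrite /K ler_nat -[4%N]/(2 ^ 2)%N leq_exp2r.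
have KA : 0 <= K ^+ 2 * alpha by rewrite mulr_ge0 ?exprn_ge0 //; lra.
have K2 : 16 <= K ^+ 2 by nra.
have s256 : 256 <= s by lra.
have sK : 64 * K <= s by nra.
have sa : 64 * alpha <= s by nra.
have sKa : 64 * (K * alpha) <= s by nra.
have sK2a : 256 * (K ^+ 2 * alpha) <= s by lra.
have s0 : 0 < s by lra.
have K0 : 0 < K by lra.
have big m : (n1 + n2 <= 4 * m)%N -> s ^+ 4 <= 4 * m%:R.
  by move=> h; rewrite s4 -natrM ler_nat.
have s34 : s ^+ 4 = s * s ^+ 3 by rewrite exprS.
have s3 : 256 <= s ^+ 3.
  apply: le_trans s256 _; rewrite -[leLHS]expr1 ler_weXn2l //; lra.
have large m : (n1 + n2 <= 4 * m)%N ->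
    [/\ (k <= m)%N, 0 < m%:R :> R & 2 * (alpha * K) <= m%:R].
  move=> /big; rewrite s34 => h.
  have h2 : s * 256 <= s * s ^+ 3 by rewrite ler_pM2l.
  have h3 : K <= m%:R by lra.
  split; [|by lra|by lra].
  rewrite -(ler_nat R); apply: le_trans h3.
  by rewrite /K ler_nat -mulnn leq_pmulr // (leq_trans _ k2).
have [k1 n10 aK1] := large _ n41; have [k2' n20 aK2] := large _ n42.
have [kn n0 aKn] := large (n1 + n2)%N (leq_pmull _ (isT : 0 < 4)%N).
(* Thinning slack: the 1 / e of [bin_ratio_ge] divided by a block size >= s ^ 4 / 4. *)
pose e := s^-1; pose eta := 4 * K / s ^+ 3.
have e01 : 0 < e <= 1 by rewrite invr_gt0 s0 invf_le1 //; lra.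
have s30 : 0 < s ^+ 3 by rewrite exprn_gt0.
have eta0 : 0 <= eta by rewrite divr_ge0 ?ltW // mulr_gt0.
have s3s : s <= s ^+ 3 by rewrite -[leLHS]expr1 ler_weXn2l //; lra.
have eta1 : eta <= 1 by rewrite /eta ler_pdivrMr // mul1r; lra.
have etam m : (n1 + n2 <= 4 * m)%N -> 0 < m%:R :> R -> K / (e * m%:R) <= eta.
  move=> h m0; rewrite /eta /e ler_pdivlMr // mulrAC ler_pdivrMr ?mulr_gt0 ?invr_gt0 //.
  have -> : 4 * K * (s^-1 * m%:R) = K * (4 * m%:R / s) by ring.
  by rewrite ler_pM2l // ler_pdivlMr // mulrC -s34 big.
pose dens m : R := alpha * m%:R / (num_kclauses k m)%:R.
have densE m : (k <= m)%N -> dens m = alpha / 2 ^+ k * (m%:R / 'C(m, k)%:R).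
  move=> km; rewrite /dens /num_kclauses natrM natrX; field.
  by rewrite -natrX !pnatr_eq0 -!lt0n bin_gt0 km expn_gt0.
have dens0 m : 0 <= dens m by rewrite divr_ge0 // mulr_ge0.
have denshalf m : (k <= m)%N -> 0 < m%:R :> R -> 2 * (alpha * K) <= m%:R -> dens m <= 2^-1.
  move=> km m0 am; apply: le_trans (clause_density_le km) _.
  by rewrite ler_pdivrMr //; lra.
have prE m : (k <= m)%N -> 2 * (alpha * K) <= m%:R -> clause_pr k m alpha = dens m.
  by move=> km am; rewrite clause_prE //; have := mulr_ge0 alpha0 (ltW K0); lra.
(* The block rates reproduce the clause probability exactly and exceed [dens m], which is the
   favourable direction. Only the large formula is thinned. *)
have rateE m : (k <= m)%N -> 0 < m%:R :> R -> 2 * (alpha * K) <= m%:R ->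
    dens m <= - ln (1 - dens m) /\ 1 - expR (- - ln (1 - dens m)) = clause_pr k m alpha.
  move=> km m0 am; have d1 := denshalf _ km m0 am; have d0 := dens0 m.
  rewrite opprK lnK ?posrE; last by lra.
  split; last by rewrite prE //; ring.
  have := @le_ln1Dx R (- dens m); lra.
have [r1 p1] := rateE _ k1 n10 aK1; have [r2 p2] := rateE _ k2' n20 aK2.
pose r := (1 - eta) * dens (n1 + n2); pose dl := alpha / 2 ^+ k * (2 * K * e).
have r0 : 0 <= r by rewrite mulr_ge0 // subr_ge0.
have dl0 : 0 <= dl.
  by rewrite /dl !mulr_ge0 ?invr_ge0 ?exprn_ge0 // ltW.
have comb a1 a2 : (a1 <= n1)%N -> (a2 <= n2)%N ->
   r * 'C(a1 + a2, k)%:R <= - ln (1 - dens n1) * 'C(a1, k)%:R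
      + - ln (1 - dens n2) * 'C(a2, k)%:R + dl.
  move=> a1n a2n.
  have h := split_bin_ratio k2 k1 k2' a1n a2n e01 eta1 (etam _ n41 n10) (etam _ n42 n20).
  have A0 : 0 <= alpha / 2 ^+ k by rewrite divr_ge0 ?exprn_ge0.
  have {}h := ler_wpM2l A0 h.
  have b1 := ler_wpM2r (ler0n R 'C(a1, k)) r1.
  have b2 := ler_wpM2r (ler0n R 'C(a2, k)) r2.
  rewrite [X in X * _ <= _]densE // in b1; rewrite [X in X * _ <= _]densE // in b2.
  rewrite /r densE // /dl.
  rewrite mulrDr mulrDr in h.
  have -> : (1 - eta) * (alpha / 2 ^+ k * ((n1 + n2)%:R / 'C(n1 + n2, k)%:R)) * 'C(a1 + a2, k)%:R
    = alpha / 2 ^+ k * ((1 - eta) * ((n1 + n2)%:R * ('C(a1 + a2, k)%:R / 'C(n1 + n2, k)%:R))) by ring.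
  apply: le_trans h _; rewrite lerD2r; apply: lerD.
    by apply: le_trans b1; rewrite le_eqVlt; apply/orP; left; apply/eqP; ring.
  by apply: le_trans b2; rewrite le_eqVlt; apply/orP; left; apply/eqP; ring.
have I := expect_lnZ_split r0 (le_trans (dens0 _) r1) (le_trans (dens0 _) r2) dl0 comb.
rewrite p1 p2 in I.
have /andP[ln20 ln21] := ln2_bounds.
set N1 : R := (n1 + n2).+1%:R in I *.
have N1E : N1 = s ^+ 4 + 1 by rewrite s4 /N1 -natr1.
have N10 : 0 <= N1 by [].
have small : 256 * (K ^+ 2 * alpha) <= s ^+ 2.
  by apply: le_trans sK2a _; rewrite -[leLHS]expr1 ler_weXn2l // (le_trans _ s256) // ler1n.
have peta : dens (n1 + n2)%N <= eta.
  apply: le_trans (clause_density_le kn) _; rewrite -s4 s34 /eta.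
  rewrite invfM mulrA ler_pM2r ?invr_gt0 // ler_pdivrMr //; nra.
have tv := expect_lnZ_rate (prE _ kn aKn) kn s0 s4 erefl small.
rewrite prE // in tv.
have {}tv := tv (denshalf _ kn n0 aKn) peta eta1.
rewrite -/eta -/r -(prE _ kn aKn) -/(g (n1 + n2)%N) in tv.
have s'0 : 0 < s^-1 by rewrite invr_gt0.
have dlE : dl <= 2 * alpha * K / s.
  have -> : 2 * alpha * K / s = alpha * (2 * K * e) by rewrite /e; ring.
  have Ke0 : 0 <= 2 * K * e by apply: mulr_ge0; [apply: mulr_ge0 => //; exact: ltW|exact: ltW].
  rewrite /dl (ler_wpM2r Ke0) // ler_piMr // invf_le1 ?exprn_gt0 //.
  by rewrite exprn_ege1 // ler1n.
have ls : ln 2 <= N1 / s :> R.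
  apply: le_trans ln21 _; rewrite ler_pdivlMr // mul1r N1E s34; nra.
have u0 : 0 <= u n1 + u n2 by rewrite addr_ge0 // unsat_ge0 // clause_pr01.
have w1 : N1 * ln 2 * (u n1 + u n2 + dl) <= N1 * (u n1 + u n2 + 2 * alpha * K / s).
  rewrite -mulrA ler_wpM2l //; apply: (@le_trans _ _ (u n1 + u n2 + dl)).
    by rewrite ler_piMl // addr_ge0.
  by rewrite lerD2l.
have tv2 := le_trans (ler_norm _) tv.
have Y0 : 0 <= N1 / s by rewrite divr_ge0 // ltW.
have E2 : N1 * (u n1 + u n2 + 2 * alpha * K / s) = N1 * (u n1 + u n2) + 2 * alpha * K * (N1 / s).
  by ring.
rewrite E2 in w1.
have I' : g n1 + g n2 - ln 2 - N1 * ln 2 * (u n1 + u n2 + dl) <=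
  expect_lnZ k (n1 + n2) (1 - expR (- r)) := I.
rewrite -(mulrA _ N1); move: I' w1 tv2 ls Y0.
move: (g (n1 + n2)%N) (g n1) (g n2) (expect_lnZ _ _ _) (N1 * (u n1 + u n2)) (N1 / s) (N1 * ln 2 * _).
move=> G G1 G2 E' V Y W; clear; lra.
Qed.
End Superadditivity.

(** * Superadditive sequences under balanced splits, and logarithmic estimates *)

Section Limit.
Context {R : realType}.

(** A form of Fekete's lemma in which each part is at least a quarter of the whole; the limit is the
    supremum of h m / m. To compare n = q m + r with m, the quotient q is halved repeatedly, and the
    remainder r follows a single branch, so it is paid for once. *)
Lemma balanced_superadd_cvg (h : nat -> R) (M : R) (N0 : nat) : (0 < N0)%N ->
  (forall n, (N0 <= n)%N -> h n <= M * n%:R) ->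
  (forall n1 n2, (N0 <= n1)%N -> (N0 <= n2)%N ->
     (n1 + n2 <= 4 * n1)%N -> (n1 + n2 <= 4 * n2)%N ->
     h n1 + h n2 <= h (n1 + n2)%N) ->
  exists l : R, (fun n => h n / n%:R) @ \oo --> l.
Proof.
move=> N00 hM hs; pose A := [set h m / m%:R | m in [set m | (N0 <= m)%N]].
have pos m : (N0 <= m)%N -> 0 < m%:R :> R by move=> ?; rewrite ltr0n; lia.
have Aub : has_ubound A.
  exists M => _ [m /= Nm <-]; rewrite ler_pdivrMr ?pos //; exact: hM.
have Asup : has_sup A by split => //; exists (h N0 / N0%:R); exists N0 => /=.
exists (sup A); apply/cvgrPdist_le => eps eps0.
have [_ [m /= Nm <-] am] := sup_adherent (divr_gt0 eps0 (ltr0n R 2)) Asup.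
(* Bounds the loss h m - h (m + r) at the one leaf that carries the remainder, for all r < m at
   once. *)
pose J := \sum_(r < m) (`|h m| + `|h (m + r)%N|).
have J0 : 0 <= J by apply: sumr_ge0 => r _; rewrite addr_ge0.
have block q r : (r < m)%N -> (0 < q)%N ->
    q%:R * h m - (if r == 0%N then 0 else J) <= h (q * m + r)%N.
  elim/ltn_ind: q r => q IH r rm q0.
  have [q1|q1] := leqP q 1.
    have -> : q = 1%N by lia.
    rewrite mul1r mul1n; case: eqP => [->|_]; first by rewrite subr0 addn0.
    rewrite lerBlDr; apply: (@le_trans _ _ (`|h m| + `|h (m + r)%N| + h (m + r)%N)).
      have := ler_norm (h m); have := ler_norm (- h (m + r)%N); rewrite normrN; lra.
    rewrite addrC lerD2l /J (bigD1 (Ordinal rm)) //= lerDl.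
    by apply: sumr_ge0 => j _; rewrite addr_ge0.
  (* The parts a m and b m + r are balanced; the tightest case is a = 1, b = 2, where the total is
     below 4 m. *)
  have [a [b [qab a0 ab ba]]] : exists a b, [/\ q = (a + b)%N, 0 < a, a <= b & b <= a.+1]%N.
    exists q./2, (q - q./2)%N; have := odd_double_half q; rewrite -addnn.
    by case: (odd q) => /= e; split; lia.
  have m0 : (0 < m)%N by apply: leq_trans Nm.
  have i1 := IH a (ltac:(lia)) 0%N m0 a0.
  have i2 := IH b (ltac:(lia)) r rm (ltac:(lia)).
  rewrite eqxx subr0 addn0 in i1.
  have -> : (q * m + r = a * m + (b * m + r))%N by rewrite qab; ring.
  apply: le_trans (hs _ _ _ _ _ _); rewrite ?qab ?natrD.
  - by rewrite mulrDl; lra.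
  - by rewrite (leq_trans Nm) // leq_pmull.
  - by rewrite (leq_trans Nm) // (leq_trans _ (leq_addr _ _)) // leq_pmull //; lia.
  - by nia.
  - by nia.
have lower n : (m <= n)%N -> n%:R * (h m / m%:R) - (`|h m| + J) <= h n.
  move=> mn; have m0 : (0 < m)%N by apply: leq_trans Nm.
  have b := block (n %/ m)%N (n %% m)%N (ltn_pmod _ m0) _.
  rewrite -divn_eq divn_gt0 // in b; apply: le_trans (b mn).
  have -> : n%:R * (h m / m%:R) = (n %/ m)%:R * h m + (n %% m)%:R / m%:R * h m.
    rewrite {1}(divn_eq n m) natrD natrM; field.
    by rewrite gt_eqF ?pos.
  have r1 : (n %% m)%:R / m%:R <= 1 :> R.
    by rewrite ler_pdivrMr ?pos // mul1r ler_nat ltnW // ltn_pmod.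
  have r0 : 0 <= (n %% m)%:R / m%:R :> R by rewrite divr_ge0.
  have : (n %% m)%:R / m%:R * h m <= `|h m|.
    apply: le_trans (ler_norm _) _.
    by rewrite normrM ger0_norm // ler_piMl.
  by case: ifP => _; lra.
near=> n.
have n0 : (N0 <= n)%N by near: n; exact: nbhs_infty_ge.
have mn : (m <= n)%N by near: n; exact: nbhs_infty_ge.
have nbig : (`|h m| + J) / (eps / 2) <= n%:R by near: n; exact: nbhs_infty_ger.
have hnA : h n / n%:R <= sup A by apply: ub_le_sup => //; exists n.
rewrite ger0_norm ?subr_ge0 // lerBlDl -lerBlDr.
rewrite ler_pdivlMr ?pos //; apply: le_trans (lower n mn).
rewrite ler_pdivrMr ?divr_gt0 // in nbig.
have : (sup A - eps / 2) * n%:R <= h m / m%:R * n%:R.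
  by rewrite ler_wpM2r // ltW.
lra.
Unshelve. all: by end_near. Qed.

(** The convex function y^(-eps) lies above its tangent at x. *)
Lemma powRN_tangent (x y eps : R) : 0 < x -> 0 < y -> 0 <= eps ->
  x `^ (- eps) + eps * (x - y) * x `^ (- (1 + eps)) <= y `^ (- eps).
Proof.
move=> x0 y0 e0.
have yx : 0 < y / x by rewrite divr_gt0.
have -> : y `^ (- eps) = x `^ (- eps) * (y / x) `^ (- eps).
  by rewrite -powRM ?ltW // mulrC divfK // gt_eqF.
have -> : x `^ (- (1 + eps)) = x `^ (- eps) / x.
  have -> : - (1 + eps) = - eps + -1 by ring.
  by rewrite powRD ?(gt_eqF x0) ?implybT // powR_inv1 // ltW.
have xe : 0 < x `^ (- eps) by rewrite powR_gt0.
have -> : x `^ (- eps) + eps * (x - y) * (x `^ (- eps) / x) =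
    x `^ (- eps) * (1 + eps * (1 - y / x)) by field; rewrite gt_eqF.
rewrite ler_pM2l // /powR gt_eqF //.
apply: le_trans (expR_ge1Dx _); rewrite lerD2l mulNr -mulrN ler_wpM2l //.
have h : ln (1 + (y / x - 1)) <= y / x - 1 by apply: le_ln1Dx; lra.
have e1 : 1 + (y / x - 1) = y / x by ring.
by rewrite e1 in h; lra.
Qed.

(** Lets the n^(3/4) error be absorbed into n / (ln n)^p. It is ln y <= y at y = x^(1/(4p)), raised
    to the power p. *)
Lemma ln_powR_le (p x : R) : 0 < p -> 1 <= x ->
  ln x `^ p <= (4 * p) `^ p * x `^ 4^-1.
Proof.
move=> p0 x1; have x0 : 0 < x by lra.
have q0 : 0 < 4 * p by lra.
have l0 : 0 <= ln x by rewrite ln_ge0.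
have h : ln x <= 4 * p * x `^ (4 * p)^-1.
  have := ltW (ln_sublinear (powR_gt0 (4 * p)^-1 x0)).
  by rewrite ln_powR mulrC ler_pdivrMr // mulrC.
have -> : x `^ 4^-1 = (x `^ (4 * p)^-1) `^ p.
  by rewrite -powRrM; congr (_ `^ _); field; rewrite gt_eqF.
rewrite -powRM ?powR_ge0 ?(ltW q0) //.
by apply: ge0_ler_powR; rewrite ?nnegrE ?(ltW p0) // mulr_ge0 ?powR_ge0 // ltW.
Qed.

Lemma ln_nat_cvg_powRN (eps : R) : 0 < eps ->
  (fun n : nat => ln (n%:R : R) `^ (- eps)) @ \oo --> (0 : R).
Proof.
move=> e0; apply/cvgrPdist_le => d d0; near=> n.
rewrite sub0r normrN ger0_norm ?powR_ge0 //.
pose X := d `^ (- eps^-1).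
have X0 : 0 < X by rewrite powR_gt0.
have nX : expR X <= n%:R by near: n; exact: nbhs_infty_ger.
have n0 : 0 < n%:R :> R by apply: lt_le_trans nX; rewrite expR_gt0.
have lX : X <= ln n%:R by rewrite -(expRK X) ler_ln ?posrE ?expR_gt0.
rewrite powRN; have -> : d = (X `^ eps)^-1.
  rewrite -powRN -powRrM mulrNN mulVf ?gt_eqF // powRr1 // ltW //.
rewrite lef_pV2 ?posrE ?powR_gt0 // ?(lt_le_trans X0) //.
by apply: ge0_ler_powR; rewrite ?nnegrE ?(ltW e0) ?(ltW X0) // (le_trans (ltW X0)).
Unshelve. all: by end_near. Qed.
End Limit.

(** * Convergence of the expectation of ln (1 + Z) divided by n *)

Section Convergence.
Context {R : realType}.

(* Subtracting a multiple of n (ln n)^(-eps) absorbs the error term. *)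
Lemma near_superadd_cvg (g : nat -> R) (M E eps : R) (N0 : nat) :
  0 < eps -> 0 <= E ->
  (forall n, (N0 <= n)%N -> g n <= M * n%:R) ->
  (forall n1 n2, (N0 <= n1)%N -> (N0 <= n2)%N ->
     (n1 + n2 <= 4 * n1)%N -> (n1 + n2 <= 4 * n2)%N ->
     g n1 + g n2 - E * (n1 + n2)%:R * ln (n1 + n2)%:R `^ (- (1 + eps)) <=
       g (n1 + n2)%N) ->
  exists l : R, (fun n => g n / n%:R) @ \oo --> l.
Proof.
move=> e0 E0 gM gs; pose w (n : nat) : R := ln n%:R `^ (- eps).
(* A part of a balanced split is at most 3/4 of the whole, so its logarithm is smaller by at least
   ln (4 / 3). By the tangent inequality w gains c (ln n)^(-(1 + eps)) there, and the coefficient E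
   / c cancels the error. *)
pose c : R := eps * ln (4 / 3).
have l43 : 0 < ln (4 / 3 : R) by rewrite ln_gt0 //; lra.
have c0 : 0 < c by rewrite mulr_gt0.
pose h n := g n - E / c * n%:R * w n.
have Ec0 : 0 <= E / c by rewrite divr_ge0 // ltW.
have step n m : (2 <= m)%N -> (4 * m <= 3 * n)%N ->
    w n + c * ln n%:R `^ (- (1 + eps)) <= w m.
  move=> m2 mn.
  have lm : 0 < ln m%:R :> R by rewrite ln_gt0 // ltr1n.
  have mn' : 4 / 3 * m%:R <= n%:R :> R.
    by move: mn; rewrite -(ler_nat R) !natrM; lra.
  have m0 : 0 < m%:R :> R by rewrite ltr0n; lia.
  have n0 : 0 < n%:R :> R by rewrite ltr0n; lia.
  have xy : ln (4 / 3) + ln m%:R <= ln n%:R :> R.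
    have t0 : 0 < 4 / 3 :> R by lra.
    by rewrite -lnM ?posrE // ler_ln ?posrE // mulr_gt0.
  have ln0 : 0 < ln n%:R :> R by lra.
  apply: le_trans (powRN_tangent ln0 lm (ltW e0)); rewrite lerD2l.
  rewrite ler_wpM2r ?powR_ge0 // /c ler_wpM2l ?(ltW e0) //; lra.
have [l hl] : exists l : R, (fun n => h n / n%:R) @ \oo --> l.
  apply: (@balanced_superadd_cvg R h M (maxn N0 2)).
  - by rewrite leq_max /= orbT.
  - move=> n; rewrite geq_max => /andP[/gM gn _]; apply: le_trans gn.
    by rewrite gerBl mulr_ge0 ?powR_ge0 // mulr_ge0.
  - move=> n1 n2; rewrite !geq_max => /andP[N1 n12] /andP[N2 n22] b1 b2.
    have s1 := step (n1 + n2)%N n1 n12 ltac:(lia).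
    have s2 := step (n1 + n2)%N n2 n22 ltac:(lia).
    have gg := gs _ _ N1 N2 b1 b2; rewrite /h.
    have {}s1 := ler_wpM2l (mulr_ge0 Ec0 (ler0n R n1)) s1.
    have {}s2 := ler_wpM2l (mulr_ge0 Ec0 (ler0n R n2)) s2.
    set W := w (n1 + n2)%N in s1 s2 *; set V := _ `^ _ in gg s1 s2.
    rewrite natrD in gg *.
    have e1 n : E / c * n%:R * (W + c * V) = E / c * n%:R * W + E * n%:R * V.
      by field; rewrite gt_eqF.
    rewrite !e1 in s1 s2. lra.
exists l.
have -> : (fun n => g n / n%:R) = (fun n => h n / n%:R + E / c * (w n * (0 < n)%N%:R)).
  apply/funext => n; rewrite /h; have [->|n0] := posnP n.
    by rewrite invr0 /= !mulr0 addr0.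
  by rewrite mulr1; field; rewrite gt_eqF // pnatr_eq0 -lt0n n0.
rewrite -[l]addr0; apply: cvgD => //.
rewrite -(mulr0 (E / c)); apply: cvgMl_tmp.
apply: cvg_trans (ln_nat_cvg_powRN e0); apply: near_eq_cvg; near=> n.
have -> : (0 < n)%N by near: n; exact: nbhs_infty_ge.
by rewrite mulr1.
Unshelve. all: by end_near. Qed.

Variables (k : nat) (alpha : R).
Hypotheses (k2 : (2 <= k)%N) (alpha0 : 0 <= alpha).
Let g n := expect_lnZ k n (clause_pr k n alpha).
Let u n := unsat k n (clause_pr k n alpha).

Lemma expect_lnZ_bounds n : 0 <= g n <= n.+1%:R.
Proof.
have p01 (C : kclause k n) : 0 <= (fun=> clause_pr k n alpha) C <= 1.
  exact: clause_pr01.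
apply/andP; split.
  rewrite -[leLHS](@expect_cst _ (kclause k n) (fun=> clause_pr k n alpha)).
  by apply: le_expect => // F _; rewrite ln_ge0 // lerDl.
rewrite -[leRHS](@expect_cst _ (kclause k n) (fun=> clause_pr k n alpha)).
apply: le_expect => // F _; apply: le_trans (ln_1D_le (Z_le F)) _.
by have /andP[_ l1] := @ln2_bounds R; rewrite ler_piMr.
Qed.

Lemma expect_lnZ_cvg (eps C : R) : 0 < eps ->
  (\forall n \near \oo, u n <= C * ln n%:R `^ (- (1 + eps))) ->
  exists l : R, (fun n => g n / n%:R) @ \oo --> l.
Proof.
move=> e0 [N _ uC]; set p := 1 + eps in uC.
have p0 : 0 < p by rewrite /p; lra.
pose K : R := (k ^ 2)%:R.
pose B := 2 * alpha * K + 128 * K ^+ 2 * alpha + 2.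
have B0 : 0 <= B by rewrite /B !addr_ge0 ?mulr_ge0 ?exprn_ge0.
pose C' := Num.max C 0.
have C'0 : 0 <= C' by rewrite le_max lexx orbT.
pose A := 256 * K ^+ 2 * (1 + alpha).
have A0 : 0 <= A.
  by apply: mulr_ge0; [apply: mulr_ge0 => //; exact: exprn_ge0|exact: addr_ge0].
have [N1 _ NA] := @nbhs_infty_ger R (A ^+ 4).
(* The first term covers unsatisfiability of the two blocks: n + 1 <= 2 n, and n <= 4 m <= m^2 gives
   ln m >= ln n / 2, whence 2^p. The second covers the error B (n + 1) / s through [ln_powR_le]. *)
pose E := 4 * C' * 2 `^ p + 2 * B * (4 * p) `^ p.
apply: (@near_superadd_cvg g 2 E eps (maxn (maxn N N1) 4)) => //.
- by rewrite /E addr_ge0 ?mulr_ge0 ?powR_ge0.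
- move=> n; rewrite !geq_max => /andP[_ n4].
  have /andP[_ gn] := expect_lnZ_bounds n; apply: le_trans gn _.
  by rewrite -natrM ler_nat; lia.
move=> n1 n2; rewrite !geq_max -!andbA => /and3P[n1N n1N1 n14] /and3P[n2N _ n24] b1 b2.
pose n := (n1 + n2)%N; rewrite -/n in b1 b2 *.
have n4 : (4 <= n)%N := leq_trans n14 (leq_addr _ _).
have n0 : 0 < n%:R :> R by rewrite ltr0n (leq_trans _ n4).
have n1' : 1 <= n%:R :> R by rewrite ler1n (leq_trans _ n4).
pose s : R := n%:R `^ 4^-1.
have s0 : 0 < s by rewrite powR_gt0.
have s4 : s ^+ 4 = n%:R.
  by rewrite -powR_mulrn ?powR_ge0 // -powRrM mulVf ?pnatr_eq0 // powRr1 // ltW.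
have As : A <= s.
  rewrite leNgt; apply/negP => sA.
  have h : s ^+ 4 < A ^+ 4 by rewrite ltrXn2r ?nnegrE // ltW.
  have := NA n _; rewrite /= -s4 => /(_ (leq_trans n1N1 (leq_addr _ _))); lra.
have super := expect_lnZ_superadd k2 alpha0 As s4 b1 b2.
have ln0 : 0 < ln n%:R :> R by rewrite ln_gt0 // ltr1n (leq_trans _ n4).
set L := ln n%:R `^ (- p).
have L0 : 0 <= L by rewrite powR_ge0.
have ub m : (N <= m)%N -> (4 <= m)%N -> (n <= 4 * m)%N -> u m <= C' * 2 `^ p * L.
  move=> Nm m4 nm; apply: le_trans (uC m Nm) _.
  have m0 : 0 < m%:R :> R by rewrite ltr0n (leq_trans _ m4).
  have lm : ln n%:R / 2 <= ln m%:R :> R.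
    rewrite ler_pdivrMr // mulr_natr -lnXn // ler_ln ?posrE ?exprn_gt0 //.
    by rewrite -natrX ler_nat (leq_trans nm) // -mulnn leq_mul2r m4 orbT.
  apply: (@le_trans _ _ (C' * ln m%:R `^ (- p))).
    by rewrite ler_wpM2r ?powR_ge0 // le_max lexx.
  rewrite -mulrA ler_wpM2l // /L !powRN.
  have -> : 2 `^ p / ln n%:R `^ p = ((ln n%:R / 2) `^ p)^-1.
    rewrite powRM ?invr_ge0 ?(ltW ln0) // invfM mulrC; congr (_ * _).
    by rewrite -[2^-1]powR_inv1 // -powRrM mulN1r powRN invrK.
  have l20 : 0 < ln n%:R / 2 :> R by rewrite divr_gt0.
  rewrite lef_pV2 ?posrE ?powR_gt0 // ?(lt_le_trans l20) //.
  apply: ge0_ler_powR; rewrite ?nnegrE ?(ltW p0) ?(ltW l20) //.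
  by rewrite (le_trans (ltW l20)).
have u1 := ub _ n1N n14 b1; have u2 := ub _ n2N n24 b2.
have sL : s^-1 <= (4 * p) `^ p * L.
  rewrite /L powRN ler_pdivlMr ?powR_gt0 // mulrC ler_pdivrMr //.
  exact: ln_powR_le.
have nn : n.+1%:R <= 2 * n%:R :> R by rewrite -natr1; lra.
have u0 m : 0 <= u m by apply: unsat_ge0; exact: clause_pr01.
have h1 : n.+1%:R * (u n1 + u n2) <= 2 * n%:R * (2 * (C' * 2 `^ p * L)).
  by apply: ler_pM => //; [rewrite addr_ge0|lra].
have h2 : B * n.+1%:R / s <= B * (2 * n%:R) * ((4 * p) `^ p * L).
  apply: ler_pM => //; rewrite ?mulr_ge0 ?invr_ge0 ?(ltW s0) //.
  by rewrite ler_wpM2l.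
apply: le_trans super; rewrite -/n -/K -/B -/(g n1) -/(g n2) -/(u n1) -/(u n2) -/p -/L.
rewrite /E; lra.
Qed.
End Convergence.

(** * From ln (1 + Z) to the conditional expectation of ln Z *)

Section Conclusion.
Context {R : realType}.
Variable k : nat.
Hypothesis k2 : (2 <= k)%N.

(** Below the supremum [alpha_star], the decay of unsatisfiability is known at some density b above
    a, and this brings it down to a. Inserting a clause only removes solutions, so every increment
    in the interpolation is nonnegative; the bound on b keeps probabilities below 1/2 and the rates
    finite. *)
Lemma unsat_mono n (a b : R) : (k <= n)%N -> 0 <= a -> a <= b ->
  b * (k ^ 2)%:R <= n%:R / 2 ->
  unsat k n (clause_pr k n a) <= unsat k n (clause_pr k n b).
Proof.
move=> kn a0 ab bn.
have n0 : 0 < n%:R :> R by rewrite ltr0n (leq_trans _ kn) // (leq_trans _ k2).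
have K0 : 0 <= (k ^ 2)%:R :> R by [].
have b0 : 0 <= b := le_trans a0 ab.
have small c : 0 <= c -> c <= b ->
    clause_pr k n c = c * n%:R / (num_kclauses k n)%:R /\ clause_pr k n c <= 2^-1.
  move=> c0 cb; have cK : c * (k ^ 2)%:R <= n%:R / 2 by apply: le_trans bn; rewrite ler_wpM2r.
  rewrite clause_prE //; last by apply: le_trans cK _; rewrite ler_pdivrMr //; lra.
  split => //; apply: le_trans (clause_density_le k2 c0 kn) _.
  by rewrite ler_pdivrMr // [leRHS]mulrC.
have [aE a2] := small a a0 ab; have [bE b2] := small b b0 (lexx _).
have [pa0 _] := andP (clause_pr01 k n a0).
have pab : clause_pr k n a <= clause_pr k n b.
  by rewrite aE bE ler_wpM2r ?invr_ge0 // ler_wpM2r.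
pose l (p : R) (C : kclause k n) := - ln (1 - p).
have lE p : p <= 2^-1 -> (fun=> p) = rate_pr (l p).
  move=> p2; apply/funext => C; rewrite /rate_pr /l opprK lnK ?posrE; last by lra.
  by ring.
have l0 p : 0 <= p -> forall C, 0 <= l p C.
  by move=> p0 C; rewrite /l oppr_ge0 ln_le0 // lerBlDr lerDl.
rewrite /unsat (lE _ a2) (lE _ b2) -[leLHS]subr0.
apply: interpolation; [by apply: l0; lra|exact: l0|move=> F].
rewrite oppr0; apply: sumr_ge0 => C _; apply: mulr_ge0.
  rewrite /l opprK addrC subr_ge0 ler_ln ?posrE; lra.
rewrite subr_ge0 ler_nat; have [Z0|//] := eqVneq (Z F) 0%N.
rewrite [X in (_ <= X)%N](_ : _ = 1%N) //; apply/eqP; rewrite eqb1 -leqn0 -Z0.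
apply: subset_leq_card; apply/fintype.subsetP => s.
rewrite !finset.inE => /forall_inP h; apply/forall_inP => D DF.
by apply: h; rewrite finset.in_setU1 DF orbT.
Qed.

Lemma unsat_prE n (a : R) : unsat_pr k n a = unsat k n (clause_pr k n a).
Proof.
rewrite /unsat_pr /Pr big_mkcond; apply: eq_bigr => F _.
by rewrite /bern -/(formula_pr a F); case: (Z F == 0%N); rewrite ?mulr1 ?mulr0.
Qed.

Lemma Pr_sat n (a : R) :
  Pr a (fun F : formula k n => (1 <= Z F)%N) = 1 - unsat_pr k n a.
Proof.
apply/eqP; rewrite eq_sym subr_eq -(formula_pr_sum1 k n a).
rewrite (bigID (fun F => (1 <= Z F)%N)) /=; apply/eqP; congr (_ + _).
by apply: eq_bigl => F; rewrite -ltnNge ltnS leqn0.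
Qed.

(** On satisfiable formulas ln (1 + Z) - ln Z lies in [0, ln 2]; on the others ln (1 + Z) = 0. *)
Lemma expect_lnZ_sat n (a : R) : 0 <= a ->
  0 <= expect_lnZ k n (clause_pr k n a) -
    \sum_(F : formula k n | (1 <= Z F)%N) formula_pr a F * ln (Z F)%:R <= 1.
Proof.
move=> a0; have p01 (C : kclause k n) := clause_pr01 k n a0.
have -> : \sum_(F : formula k n | (1 <= Z F)%N) formula_pr a F * ln (Z F)%:R =
    expect (fun=> clause_pr k n a)
      (fun F : formula k n => if (1 <= Z F)%N then ln (Z F)%:R else 0).
  rewrite big_mkcond; apply: eq_bigr => F _.
  by case: ifP; rewrite ?mulr0.
rewrite -expectB -[leLHS](@expect_cst _ (kclause k n) (fun=> clause_pr k n a)).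
rewrite -[X in _ && (_ <= X)](@expect_cst _ (kclause k n) (fun=> clause_pr k n a)).
have /andP[l20 l21] := @ln2_bounds R.
apply/andP; split; apply: le_expect => // F _; case: ifP => [Z1|/negbT].
- by rewrite subr_ge0 ler_ln ?posrE ?ltr_wpDr ?ltr0n // lerDr.
- by rewrite subr0 ln_ge0 // lerDl.
- rewrite -ln_div ?posrE ?ltr_wpDr ?ltr0n //; apply: le_trans l21.
  have Z0 : 0 < (Z F)%:R :> R by rewrite ltr0n.
  have Z1' : 1 <= (Z F)%:R :> R by rewrite ler1n.
  rewrite ler_ln ?posrE ?divr_gt0 ?ltr_wpDr // ler_pdivrMr //.
  by rewrite mulr_natl mulr2n lerD2r.
- by rewrite -eqn0Ngt => /eqP ->; rewrite addr0 ln1 subr0.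
Qed.

Lemma psi_cvg (a : R) : 0 <= a -> (a%:E < alpha_star R k)%E ->
  exists l : R, psi k n a @[n --> \oo] --> l.
Proof.
move=> a0 /ereal_sup_gt[_ [b [b0 [eps e0 bO]] <-]]; rewrite lte_fin => /ltW ab.
have /eqO_exP[c c0 bc] := bO.
pose u n := unsat k n (clause_pr k n a).
pose g n := expect_lnZ k n (clause_pr k n a).
have u0 n : 0 <= u n by apply: unsat_ge0; exact: clause_pr01.
have ubnd : \forall n \near \oo, u n <= c * ln n%:R `^ (- (1 + eps)).
  near=> n.
  have kn : (k <= n)%N by near: n; exact: nbhs_infty_ge.
  have bn : 2 * (b * (k ^ 2)%:R) <= n%:R by near: n; exact: nbhs_infty_ger.
  have : `|unsat_pr k n b| <= c * `|1 / ln n%:R `^ (1 + eps)| by near: n.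
  rewrite div1r -powRN [X in _ <= _ * X]ger0_norm ?powR_ge0 //; apply: le_trans.
  apply: le_trans (ler_norm _); rewrite unsat_prE; apply: unsat_mono => //.
  by rewrite ler_pdivlMr // mulrC.
have [l gl] : exists l : R, g n / n%:R @[n --> \oo] --> l := expect_lnZ_cvg k2 a0 e0 ubnd.
exists l.
have uc : u n @[n --> \oo] --> (0 : R).
  apply: (@squeeze_cvgr _ _ _ _ (fun=> 0) (fun n => c * ln n%:R `^ (- (1 + eps)))).
  - by near=> n; rewrite u0 /=; near: n.
  - exact: cvg_cst.
  - rewrite -(mulr0 c); apply: cvgMl_tmp; apply: ln_nat_cvg_powRN; lra.
pose d n := g n - \sum_(F : formula k n | (1 <= Z F)%N) formula_pr a F * ln (Z F)%:R.
have d01 n : 0 <= d n <= 1 by exact: expect_lnZ_sat.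
have dc : d n / n%:R @[n --> \oo] --> (0 : R).
  apply/cvgrPdist_le => del del0; near=> n.
  have nd : del^-1 <= n%:R by near: n; exact: nbhs_infty_ger.
  have n0 : 0 < n%:R :> R by apply: lt_le_trans nd; rewrite invr_gt0.
  have /andP[dn0 dn1] := d01 n.
  rewrite sub0r normrN ger0_norm ?divr_ge0 // ler_pdivrMr //.
  by apply: le_trans dn1 _; rewrite mulrC -ler_pdivrMr // div1r.
(* Conditioning divides by the probability of satisfiability, which tends to 1, and d n / n <= 1 / n
   is the price of the added 1. *)
have -> : (fun n => psi k n a) = (fun n => (g n / n%:R - d n / n%:R) * (1 - u n)^-1).
  apply/funext => n; rewrite /psi /cond_expectation Pr_sat unsat_prE -/(u n) /d.
  by ring.
have -> : l = (l - 0) * (1 - 0)^-1 by rewrite !subr0 invr1 mulr1.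
apply: cvgM; first exact: cvgB.
apply: cvgV; first by rewrite subr0.
by apply: cvgB => //; exact: cvg_cst.
Unshelve. all: by end_near. Qed.
End Conclusion.

Theorem theorem3 (R : realType) (k : nat) (hk : (2 <= k)%N) :
  exists phi_s : R -> R,
    forall alpha : R, 0 <= alpha -> (alpha%:E < alpha_star R k)%E ->
      psi k n alpha @[n --> \oo] --> phi_s alpha.
Proof.
exists (fun alpha => lim (psi k n alpha @[n --> \oo])) => alpha a0 a_lt.
by have [l psil] := psi_cvg hk a0 a_lt; apply: cvgP psil.
Qed.
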